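(* Let $G$ be a finite group, $V$ a finite-dimensional ${\mathbb Q}$-vector space, and $\rho\colon G\hookrightarrow \operatorname{Aut}(V)$ a faithful irreducible rational representation. Then there exist a finite Galois extension of number fields $L/K$, an abelian variety $A$ defined over $K$, an isomorphism ${\rm Gal}(L/K)\to G$, and a ${\rm Gal}(L/K)$-stable subspace $W$ of $A(L)\otimes{\mathbb Q}$ such that, transporting the ${\rm Gal}(L/K)$-action to a $G$-action via this isomorphism, $W$ is isomorphic to $V$ as a ${\mathbb Q}[G]$-module.
   Context: For a Galois extension $L/K$ of number fields and an abelian variety $A/K$, the group ${\rm Gal}(L/K)$ acts on $A(L)$, making $A(L)\otimes{\mathbb Q}$ a ${\mathbb Q}[{\rm Gal}(L/K)]$-module. *)

(* Defs.v *)
From HB Require Import structures.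
From mathcomp Require Import all_boot all_order all_algebra all_fingroup all_field.
From mathcomp Require Import mxrepresentation boolp mpoly ring.
From mathcomp Require Import generic_quotient.

Set Implicit Arguments.
Unset Strict Implicit.
Unset Printing Implicit Defensive.

Import GRing.Theory.
Local Open Scope ring_scope.
Local Open Scope quotient_scope.

(* The tensor product of an abelian group M with Q, built as the localization
   of M at the nonzero integers; tensQ_universal below is the universal
   property of the tensor product for biadditive maps M x Q -> U. *)
Section TensorQ.
Variable M : zmodType.

Local Notation nzint := {d : int | d != 0}.
Local Notation frac := (M * nzint)%type.
Implicit Types x y z : frac.

Definition nzint_mul (a b : nzint) : nzint :=
  exist _ (val a * val b) (mulf_neq0 (valP a) (valP b)).
Definition nzint1 : nzint := exist _ 1 (oner_neq0 int).
Definition nzint_denq (r : rat) : nzint := exist _ (denq r) (denq_neq0 r).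

(* (m, d) stands for the tensor of m and 1 / d *)
Definition tensQ_rel x y : bool :=
  `[< exists2 t : int, t != 0 & x.1 *~ (t * val y.2) = y.1 *~ (t * val x.2) >].

Fact tensQ_rel_refl : reflexive tensQ_rel.
Proof. by move=> x; apply/asboolP; exists 1. Qed.

Fact tensQ_rel_sym : ssrbool.symmetric tensQ_rel.
Proof. by move=> x y; apply/asboolP/asboolP => -[t t0 e]; exists t. Qed.

Fact tensQ_rel_trans : transitive tensQ_rel.
Proof.
move=> y x z /asboolP[t t0 e] /asboolP[s s0 f]; apply/asboolP.
exists (t * s * val y.2); first by rewrite !mulf_neq0 // (valP y.2).
have -> : t * s * val y.2 * val z.2 = t * val y.2 * (s * val z.2) by ring.
have -> : t * s * val y.2 * val x.2 = s * val y.2 * (t * val x.2) by ring.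
by rewrite mulrzA e mulrzAC f -mulrzA.
Qed.

Canonical tensQ_equiv :=
  EquivRel tensQ_rel tensQ_rel_refl tensQ_rel_sym tensQ_rel_trans.

Definition tensQ : Type := {eq_quot tensQ_rel}.
HB.instance Definition _ : EqQuotient _ tensQ_rel tensQ := EqQuotient.on tensQ.
HB.instance Definition _ := Choice.on tensQ.

Lemma tensQ_eqP x y :
  reflect (exists2 t : int, t != 0 & x.1 *~ (t * val y.2) = y.1 *~ (t * val x.2))
          (\pi_tensQ x == \pi_tensQ y).
Proof. by rewrite eqmodE; apply: asboolP. Qed.

Lemma tensQ_reprP x :
  exists2 t : int, t != 0 &
    (repr (\pi_tensQ x)).1 *~ (t * val x.2) =
    x.1 *~ (t * val (repr (\pi_tensQ x)).2).
Proof. by apply/tensQ_eqP; rewrite reprK. Qed.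

Definition frac_opp x : frac := (- x.1, x.2).
Definition frac_add x y : frac :=
  (x.1 *~ val y.2 + y.1 *~ val x.2, nzint_mul x.2 y.2).
Definition frac_scale (r : rat) x : frac :=
  (x.1 *~ numq r, nzint_mul (nzint_denq r) x.2).

Definition tensQ_zero : tensQ := \pi_tensQ (0, nzint1).
Definition tensQ_opp := lift_op1 tensQ frac_opp.
Definition tensQ_add := lift_op2 tensQ frac_add.
Definition tensQ_scale r := lift_op1 tensQ (frac_scale r).

Lemma tensQ_oppE x : tensQ_opp (\pi_tensQ x) = \pi_tensQ (frac_opp x).
Proof.
unlock tensQ_opp; apply/eqP/tensQ_eqP; have [t t0 e] := tensQ_reprP x.
by exists t => //=; rewrite !mulNrz e.
Qed.

Lemma tensQ_addE x y :
  tensQ_add (\pi_tensQ x) (\pi_tensQ y) = \pi_tensQ (frac_add x y).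
Proof.
unlock tensQ_add; apply/eqP/tensQ_eqP => /=.
have [t t0 e] := tensQ_reprP x; have [s s0 f] := tensQ_reprP y.
move: (repr (\pi_tensQ x)) (repr (\pi_tensQ y)) e f => x' y' e f.
exists (t * s); first by rewrite mulf_neq0.
rewrite !mulrzDl -!mulrzA; congr (_ + _).
  have -> : val y'.2 * (t * s * (val x.2 * val y.2)) =
            t * val x.2 * (s * val y.2 * val y'.2) by ring.
  by rewrite mulrzA e -mulrzA; congr (_ *~ _); ring.
have -> : val x'.2 * (t * s * (val x.2 * val y.2)) =
          s * val y.2 * (t * val x.2 * val x'.2) by ring.
by rewrite mulrzA f -mulrzA; congr (_ *~ _); ring.
Qed.

Lemma tensQ_scaleE r x :
  tensQ_scale r (\pi_tensQ x) = \pi_tensQ (frac_scale r x).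
Proof.
unlock tensQ_scale; apply/eqP/tensQ_eqP => /=; have [t t0 e] := tensQ_reprP x.
move: (repr (\pi_tensQ x)) e => x' e; exists t => //.
rewrite -!mulrzA.
have -> : numq r * (t * (denq r * val x.2)) = t * val x.2 * (numq r * denq r)
  by ring.
by rewrite mulrzA e -mulrzA; congr (_ *~ _); ring.
Qed.

Fact tensQ_addA : associative tensQ_add.
Proof.
elim/quotW=> x; elim/quotW=> y; elim/quotW=> z; rewrite !tensQ_addE /=.
apply/eqP/tensQ_eqP; exists 1 => //=; rewrite !mulrzDl -!mulrzA addrA.
by congr (_ *~ _ + _ *~ _ + _ *~ _); ring.
Qed.

Fact tensQ_addC : commutative tensQ_add.
Proof.
elim/quotW=> x; elim/quotW=> y; rewrite !tensQ_addE /frac_add addrC; congr (\pi_tensQ (_, _)).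
by apply: val_inj; rewrite /= mulrC.
Qed.

Fact tensQ_add0 : left_id tensQ_zero tensQ_add.
Proof.
elim/quotW=> x; rewrite tensQ_addE /frac_add /= mul0rz add0r mulr1z.
by apply/eqP/tensQ_eqP; exists 1 => //=; rewrite !mul1r.
Qed.

Fact tensQ_addN : left_inverse tensQ_zero tensQ_opp tensQ_add.
Proof.
elim/quotW=> x; rewrite tensQ_oppE tensQ_addE /frac_add /= mulNrz addNr.
by apply/eqP/tensQ_eqP; exists 1 => //=; rewrite !mul0rz.
Qed.

HB.instance Definition _ :=
  GRing.isZmodule.Build tensQ tensQ_addA tensQ_addC tensQ_add0 tensQ_addN.

Lemma tensQ_addrE x y : \pi_tensQ x + \pi_tensQ y = \pi_tensQ (frac_add x y).
Proof. exact: tensQ_addE. Qed.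

Fact tensQ_scaleA r s X : tensQ_scale r (tensQ_scale s X) = tensQ_scale (r * s) X.
Proof.
elim/quotW: X => x; rewrite !tensQ_scaleE /=.
apply/eqP/tensQ_eqP; exists 1 => //=; rewrite -!mulrzA; congr (_ *~ _).
have : numq s * numq r * denq (r * s) = numq (r * s) * (denq r * denq s).
  apply: (@intr_inj rat); rewrite !rmorphM /= !numqE; ring.
by move=> e; rewrite mul1r mulrA mulrA e; ring.
Qed.

Fact tensQ_scale1 : left_id 1 tensQ_scale.
Proof.
elim/quotW=> x; rewrite tensQ_scaleE.
by apply/eqP/tensQ_eqP; exists 1 => //=; rewrite mulr1z !mul1r.
Qed.

Fact tensQ_scaleDr : right_distributive tensQ_scale +%R.
Proof.
move=> r; elim/quotW=> x; elim/quotW=> y.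
rewrite !tensQ_addrE !tensQ_scaleE tensQ_addrE /=.
apply/eqP/tensQ_eqP; exists 1 => //=; rewrite !mulrzDl -!mulrzA.
by congr (_ *~ _ + _ *~ _); ring.
Qed.

Fact tensQ_scaleDl X : {morph tensQ_scale^~ X : r s / r + s}.
Proof.
elim/quotW: X => x r s; rewrite !tensQ_scaleE tensQ_addrE /=.
apply/eqP/tensQ_eqP; exists 1 => //=; rewrite -!mulrzA -mulrzDr -mulrzA.
congr (_ *~ _).
have : numq (r + s) * (denq r * denq s) =
       (numq r * denq s + numq s * denq r) * denq (r + s).
  apply: (@intr_inj rat); rewrite !(rmorphM, rmorphD) /= !numqE; ring.
rewrite !mul1r => e.
have -> : numq (r + s) * (denq r * val x.2 * (denq s * val x.2)) =
  numq (r + s) * (denq r * denq s) * (val x.2 * val x.2) by ring.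
by rewrite e; ring.
Qed.

HB.instance Definition _ := GRing.Zmodule_isLmodule.Build rat tensQ
  tensQ_scaleA tensQ_scale1 tensQ_scaleDr tensQ_scaleDl.

(* The pure tensor of m and r *)
Definition tens (m : M) (r : rat) : tensQ := \pi_tensQ (m *~ numq r, nzint_denq r).

Lemma tensDl r : {morph tens^~ r : m m' / m + m'}.
Proof.
move=> m m'; rewrite /tens tensQ_addrE /=.
apply/eqP/tensQ_eqP; exists 1 => //=; rewrite -!mulrzA -mulrzDl -mulrzA.
by congr (_ *~ _); ring.
Qed.

Lemma tensDr m : {morph tens m : r s / r + s}.
Proof.
move=> r s; rewrite /tens tensQ_addrE /=.
apply/eqP/tensQ_eqP; exists 1 => //=; rewrite -!mulrzA -mulrzDr -mulrzA.
congr (_ *~ _); rewrite !mul1r.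
apply: (@intr_inj rat); rewrite !(rmorphM, rmorphD) /= !numqE; ring.
Qed.

Lemma tensZ r m s : r *: tens m s = tens m (r * s).
Proof.
rewrite [LHS]tensQ_scaleE; apply/eqP/tensQ_eqP; exists 1 => //=.
rewrite -!mulrzA; congr (_ *~ _); rewrite !mul1r.
apply: (@intr_inj rat); rewrite !rmorphM /= !numqE; ring.
Qed.

Lemma tensQ_piE x : \pi_tensQ x = tens x.1 (val x.2)%:~R^-1.
Proof.
apply/eqP/tensQ_eqP; exists 1 => //=; rewrite -mulrzA !mul1r; congr (_ *~ _).
have x0 : (val x.2)%:~R != 0 :> rat by rewrite intr_eq0 (valP x.2).
by apply: (@intr_inj rat); rewrite !rmorphM /= !numqE mulrAC mulVf ?mul1r.
Qed.

Lemma tens_eq0P m :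
  reflect (exists2 t : int, t != 0 & m *~ t = 0) (tens m 1 == 0).
Proof.
apply: (iffP (tensQ_eqP _ _)) => /= -[t t0 e]; exists t => //.
  by move: e; rewrite mulr1z !mulr1 mul0rz.
by rewrite mulr1z !mulr1 mul0rz.
Qed.

Lemma tensQ_universal (U : zmodType) (B : M -> rat -> U) :
    (forall r, {morph B^~ r : m m' / m + m'}) ->
    (forall m, {morph B m : r s / r + s}) ->
  exists g : {additive tensQ -> U}, (forall m r, g (tens m r) = B m r) /\
    forall h : {additive tensQ -> U}, (forall m r, h (tens m r) = B m r) ->
    h =1 g.
Proof.
move=> Bl Br.
have Bl0 r : B 0 r = 0 by apply: (addIr (B 0 r)); rewrite -Bl !add0r.
have Br0 m : B m 0 = 0 by apply: (addIr (B m 0)); rewrite -Br !add0r.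
have BlN m r : B (- m) r = - B m r.
  by apply/eqP; rewrite -addr_eq0 -Bl addNr Bl0.
have BrN m r : B m (- r) = - B m r.
  by apply/eqP; rewrite -addr_eq0 -Br addNr Br0.
have Bz m (k : int) r : B (m *~ k) r = B m (k%:~R * r).
  have Bn (n : nat) : B (m *+ n) r = B m (n%:R * r).
    elim: n => [|n IHn]; first by rewrite mulr0n mul0r Bl0 Br0.
    by rewrite mulrS Bl IHn -Br -natr1 mulrDl mul1r addrC.
  by case: k => n; rewrite ?NegzE ?mulrNz ?rmorphN ?BlN ?mulNr ?BrN /= -!pmulrn Bn.
pose g0 x := B x.1 (val x.2)%:~R^-1.
have nz x : (val x.2)%:~R != 0 :> rat by rewrite intr_eq0 (valP x.2).
have g0P x y : \pi_tensQ x = \pi_tensQ y -> g0 x = g0 y.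
  move/eqP/tensQ_eqP => [t t0 e]; rewrite /g0.
  have t0' : t%:~R != 0 :> rat by rewrite intr_eq0.
  have -> : (val x.2)%:~R^-1 = (t * val y.2)%:~R *
      ((t * val x.2)%:~R^-1 * (val y.2)%:~R^-1) :> rat.
    by rewrite !rmorphM /= [RHS]mulrC; field; rewrite t0' !nz.
  rewrite -Bz e Bz; congr B; rewrite !rmorphM /=.
  by field; rewrite t0' !nz.
pose g (X : tensQ) : U := g0 (repr X).
have gE x : g (\pi_tensQ x) = g0 x by apply: g0P; rewrite reprK.
have gD : {morph g : X Y / X + Y}.
  elim/quotW=> x; elim/quotW=> y; rewrite tensQ_addrE !gE /g0 /frac_add /=.
  rewrite Bl !Bz rmorphM /=; congr (B _ _ + B _ _); by field; rewrite !nz.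
have gN : nmod_morphism g.
  by split=> //; rewrite [0 in LHS](_ : _ = \pi_tensQ (0, nzint1)) // gE /g0 Bl0.
pose gm : {additive tensQ -> U} :=
  HB.pack g (GRing.isNmodMorphism.Build tensQ U g gN).
have gT m r : gm (tens m r) = B m r.
  rewrite /= /tens gE /g0 Bz /=; congr B; exact: divq_num_den.
exists gm; split=> // h hT; elim/quotW => x.
by rewrite tensQ_piE hT gT.
Qed.

End TensorQ.

Section TensorQMap.
Variables (M N : zmodType) (f : {additive M -> N}).

Definition tensQ_map (X : tensQ M) : tensQ N :=
  let x := repr X in \pi_(tensQ N) (f x.1, x.2).

Lemma tensQ_mapE x : tensQ_map (\pi_(tensQ M) x) = \pi_(tensQ N) (f x.1, x.2).
Proof.
apply/eqP/tensQ_eqP; have [t t0 e] := tensQ_reprP x; exists t => //=.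
by rewrite -!raddfMz e.
Qed.

Fact tensQ_map_is_linear : linear tensQ_map.
Proof.
move=> r; elim/quotW=> x; elim/quotW=> y.
rewrite !tensQ_mapE -![_ *: _]/(tensQ_scale _ _) !tensQ_scaleE !tensQ_addrE.
rewrite tensQ_mapE /frac_add /=; congr (\pi_(tensQ N) (_, _)).
by rewrite raddfD /= !raddfMz.
Qed.

HB.instance Definition _ :=
  GRing.isLinear.Build rat (tensQ M) (tensQ N) _ tensQ_map tensQ_map_is_linear.

Lemma tensQ_map_tens m r : tensQ_map (tens m r) = tens (f m) r.
Proof. by rewrite /tens tensQ_mapE /= raddfMz. Qed.
End TensorQMap.

Lemma vline_scale (F : fieldType) (V : vectType F) a (v : V) :
  a != 0 -> <[a *: v]>%VS = <[v]>%VS.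
Proof.
move=> a0; apply/eqP; rewrite eqEsubv -!memvE memvZ ?memv_line //=.
by rewrite -[v in v \in _](scalerK a0) memvZ ?memv_line.
Qed.

(* A point of P^n(F) is a line of F^(n+1); coords picks homogeneous coordinates. *)
Section ProjectiveSpace.
Variables (F : fieldType) (n : nat).

Definition projpt := {U : {vspace 'rV[F]_n.+1} | \dim U == 1%N}.
HB.instance Definition _ := Choice.on projpt.

Definition coords (p : projpt) : 'rV[F]_n.+1 := vpick (val p).

Lemma coords_neq0 p : coords p != 0.
Proof. by rewrite vpick0 -dimv_eq0 (eqP (valP p)). Qed.

Lemma coordsK p : <[coords p]>%VS = val p.
Proof.
apply/eqP; rewrite eqEdim -memvE memv_pick /=.
by rewrite dim_vline coords_neq0 (eqP (valP p)).
Qed.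

Definition proj_class v (v0 : v != 0) : projpt :=
  exist _ <[v]>%VS (introT eqP (etrans (dim_vline v) (congr1 nat_of_bool v0))).

Lemma coords_class v (v0 : v != 0) :
  exists2 c, c != 0 & coords (proj_class v0) = c *: v.
Proof.
have /vlineP[c e] : coords (proj_class v0) \in <[v]>%VS by apply: memv_pick.
exists c => //; apply: contraNneq (coords_neq0 (proj_class v0)) => c0.
by rewrite e c0 scale0r.
Qed.
End ProjectiveSpace.

Definition base_change_pt (F F' : fieldType) n (phi : {rmorphism F -> F'})
    (p : projpt F n) : projpt F' n :=
  proj_class (etrans (congr1 negb (map_mx_eq0 phi (coords p))) (coords_neq0 p)).

Definition homogeneous (R : nzRingType) n (f : {mpoly R[n]}) :=
  exists d, f \is d.-homog.

(* A Zariski closed subset of P^n defined over K, as a zero locus *)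
Record closedSet (K : fieldType) (n : nat) := ClosedSet {
  equations :> seq {mpoly K[n.+1]};
  homogeneous_equations : forall f, f \in equations -> homogeneous f
}.

Definition on (K F : fieldType) (iota : {rmorphism K -> F}) n
    (X : closedSet K n) : pred (projpt F n) :=
  fun p => all (fun f => mmap iota (coords p 0) f == 0) X.

Definition points (K F : fieldType) (iota : {rmorphism K -> F}) n
    (X : closedSet K n) := {p : projpt F n | on iota X p}.

Lemma mmap_dhomog (R S : comNzRingType) (h : {rmorphism R -> S}) n d
    (f : {mpoly R[n]}) (u : 'I_n -> S) c :
  f \is d.-homog -> mmap h (fun i => c * u i) f = c ^+ d * mmap h u f.
Proof.
move=> /dhomogP hf; rewrite /mmap mulr_sumr; apply: eq_big_seq => m mf.
rewrite mulrCA; congr (_ * _); rewrite /mmap1.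
rewrite -(hf m mf) /= mdegE -prodrXr -big_split /=.
by apply: eq_bigr => i _; rewrite exprMn.
Qed.

Lemma mmap_eq (R S : comNzRingType) (h : R -> S) n (u v : 'I_n -> S)
    (f : {mpoly R[n]}) :
  u =1 v -> mmap h u f = mmap h v f.
Proof. by move=> uv; apply: eq_bigr => m _; rewrite (mmap1_eq _ uv). Qed.

Lemma mmap_comp (K F F' : fieldType) (iota : {rmorphism K -> F})
    (iota' : {rmorphism K -> F'}) (phi : {rmorphism F -> F'})
    (phiK : forall k, phi (iota k) = iota' k) n (u : 'I_n -> F) f :
  mmap iota' (phi \o u) f = phi (mmap iota u f).
Proof.
rewrite /mmap rmorph_sum; apply: eq_bigr => m _.
rewrite rmorphM phiK; congr (_ * _).
by rewrite /mmap1 rmorph_prod; apply: eq_bigr => i _; rewrite rmorphXn.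
Qed.

Arguments mmap_comp {K F F' iota iota' phi} phiK {n} u f.

Section BaseChange.
Variables (K F F' : fieldType) (n : nat).
Variables (iota : {rmorphism K -> F}) (iota' : {rmorphism K -> F'}).
Variables (phi : {rmorphism F -> F'}) (phiK : forall k, phi (iota k) = iota' k).

Lemma coords_base_change (p : projpt F n) :
  exists2 c, c != 0 & coords (base_change_pt phi p) = c *: map_mx phi (coords p).
Proof. exact: coords_class. Qed.

Fact base_change_on (X : closedSet K n) (p : points iota X) :
  on iota' X (base_change_pt phi (val p)).
Proof.
apply/allP => f fX; have [d fd] := homogeneous_equations fX.
have [c _ e] := coords_base_change (val p).
have -> : mmap iota' (coords (base_change_pt phi (val p)) 0) f =
          mmap iota' (fun i => c * (phi \o coords (val p) 0) i) f.
  by apply: mmap_eq => i; rewrite e !mxE.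
rewrite (mmap_dhomog iota' _ c fd) (mmap_comp phiK) (eqP (allP (valP p) f fX)).
by rewrite rmorph0 mulr0.
Qed.

Definition base_change (X : closedSet K n) (p : points iota X) : points iota' X :=
  exist _ (base_change_pt phi (val p)) (base_change_on p).
End BaseChange.

Definition constant_point (K F : fieldType) (iota : {rmorphism K -> F}) n
    (X : closedSet K n) (p : points (idfun : K -> K) X) : points iota X :=
  base_change (iota := idfun) (phi := iota) (fun=> erefl) p.

(* Bidegree (d, e) in the first m and in the last n variables *)
Definition bihomogeneous (R : nzRingType) m n d e (f : {mpoly R[m + n]}) :=
  {in msupp f, forall a : 'X_{1..m + n},
    (\sum_(i < m) a (lshift n i) = d)%N /\ (\sum_(j < n) a (rshift m j) = e)%N}.

Definition eval_row (K F : fieldType) (iota : {rmorphism K -> F}) m r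
    (l : 'rV[{mpoly K[m]}]_r) (u : 'rV[F]_m) : 'rV[F]_r :=
  map_mx (mmap iota (u 0)) l.

Lemma eval_bihomogeneous (K F : fieldType) (iota : {rmorphism K -> F})
    m n r (l : 'rV[{mpoly K[m + n]}]_r) d e (u : 'rV[F]_m) (v : 'rV[F]_n) b c :
    (forall j, bihomogeneous d e (l 0 j)) ->
  eval_row iota l (row_mx (b *: u) (c *: v)) =
  (b ^+ d * c ^+ e) *: eval_row iota l (row_mx u v).
Proof.
move=> hl; apply/rowP => j; rewrite !mxE /mmap mulr_sumr.
apply: eq_big_seq => a /(hl j)[<- <-].
rewrite mulrCA; congr (_ * _); rewrite /mmap1 !big_split_ord /= -!prodrXr.
rewrite mulrACA -!big_split /=; congr (_ * _); apply: eq_bigr => i _.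
  by rewrite !row_mxEl !mxE exprMn.
by rewrite !row_mxEr !mxE exprMn.
Qed.

Definition geometrically_irreducible (K : fieldType) n (X : closedSet K n) :=
  forall (Omega : closedFieldType) (iota : {rmorphism K -> Omega}),
    inhabited (points iota X) /\
    forall Y Z : closedSet Omega n,
      (forall p : points iota X, on idfun Y (val p) || on idfun Z (val p)) ->
      (forall p : points iota X, on idfun Y (val p)) \/
      (forall p : points iota X, on idfun Z (val p)).

Section Morphisms.
Variables (K : fieldType) (n : nat) (X : closedSet K n).

(* Morphisms X -> X and X x X -> X over K: maps on the points over all field
   extensions of K that are given, on an open cover, by tuples of (bi)homogeneous
   polynomials over K of the same (bi)degree. *)
Definition morphism1
    (f : forall (F : fieldType) (iota : {rmorphism K -> F}),
       points iota X -> points iota X) :=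
  exists laws : seq 'rV[{mpoly K[n.+1]}]_n.+1,
    (forall l, l \in laws -> exists d, forall j, l 0 j \is d.-homog) /\
    forall (F : fieldType) (iota : {rmorphism K -> F}) (p : points iota X),
      let value l := eval_row iota l (coords (val p)) in
      (exists2 l, l \in laws & value l != 0) /\
      forall l, l \in laws -> value l != 0 ->
        val (val (f F iota p)) = <[value l]>%VS.

Definition morphism2
    (f : forall (F : fieldType) (iota : {rmorphism K -> F}),
       points iota X -> points iota X -> points iota X) :=
  exists laws : seq 'rV[{mpoly K[n.+1 + n.+1]}]_n.+1,
    (forall l, l \in laws ->
       exists d e, forall j, bihomogeneous d e (l 0 j)) /\
    forall (F : fieldType) (iota : {rmorphism K -> F}) (p q : points iota X),
      let value l := eval_row iota l (row_mx (coords (val p)) (coords (val q))) in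
      (exists2 l, l \in laws & value l != 0) /\
      forall l, l \in laws -> value l != 0 ->
        val (val (f F iota p q)) = <[value l]>%VS.
End Morphisms.

(* A projective, geometrically irreducible group variety over a number field.
   The equations need not generate a radical ideal: the variety is their zero
   locus with the reduced structure, which is geometrically reduced because K is
   perfect. Such a group variety is automatically smooth, since over an
   algebraic closure it has a smooth point and translations act transitively. *)
Record abelianVariety (K : fieldExtType rat) := AbelianVariety {
  av_ambient : nat;
  av_set :> closedSet K av_ambient;
  av_irreducible : geometrically_irreducible av_set;
  av_add : forall (F : fieldType) (iota : {rmorphism K -> F}),
    points iota av_set -> points iota av_set -> points iota av_set;
  av_opp : forall (F : fieldType) (iota : {rmorphism K -> F}),
    points iota av_set -> points iota av_set;
  av_zero : points (idfun : K -> K) av_set;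
  av_add_morphism : morphism2 av_add;
  av_opp_morphism : morphism1 av_opp;
  av_addA : forall (F : fieldType) (iota : {rmorphism K -> F}),
    associative (@av_add F iota);
  av_addC : forall (F : fieldType) (iota : {rmorphism K -> F}),
    commutative (@av_add F iota);
  av_add0 : forall (F : fieldType) (iota : {rmorphism K -> F}),
    left_id (constant_point iota av_zero) (@av_add F iota);
  av_addN : forall (F : fieldType) (iota : {rmorphism K -> F}),
    left_inverse (constant_point iota av_zero)
                 (@av_opp F iota) (@av_add F iota)
}.

Section RationalPoints.
Variables (K : fieldExtType rat) (A : abelianVariety K).

(* The group A(F), for F an extension of K through iota *)
Definition rational_points (F : fieldType) (iota : {rmorphism K -> F}) : Type :=
  points iota A.

Section Group.
Variables (F : fieldType) (iota : {rmorphism K -> F}).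
HB.instance Definition _ := Choice.on (rational_points iota).
HB.instance Definition _ := GRing.isZmodule.Build (rational_points iota)
  (@av_addA K A F iota) (@av_addC K A F iota)
  (@av_add0 K A F iota) (@av_addN K A F iota).
End Group.

Section Functoriality.
Variables (F F' : fieldType).
Variables (iota : {rmorphism K -> F}) (iota' : {rmorphism K -> F'}).
Variables (phi : {rmorphism F -> F'}) (phiK : forall k, phi (iota k) = iota' k).

Definition rational_points_map (p : rational_points iota) :
  rational_points iota' := base_change phiK p.

Fact rational_points_mapD :
  {morph rational_points_map : p q / p + q}.
Proof.
move=> p q; have [laws [hom laws_ok]] := av_add_morphism A.
have [[l l_in nz] /(_ l l_in nz) e] := laws_ok F iota p q.
have [d [d' hl]] := hom l l_in.
have [_ /(_ l l_in)] :=
  laws_ok F' iota' (rational_points_map p) (rational_points_map q).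
have [b b0 pE] := coords_base_change phi (val p).
have [c c0 qE] := coords_base_change phi (val q).
have -> : eval_row iota' l (row_mx (coords (val (rational_points_map p)))
                                   (coords (val (rational_points_map q)))) =
    (b ^+ d * c ^+ d') *:
      map_mx phi (eval_row iota l (row_mx (coords (val p)) (coords (val q)))).
  rewrite [coords (val (rational_points_map p))]pE.
  rewrite [coords (val (rational_points_map q))]qE (eval_bihomogeneous _ _ _ _ _ hl).
  congr (_ *: _); apply/rowP => j; rewrite !mxE -(mmap_comp phiK).
  by rewrite -map_row_mx; apply: mmap_eq => i; rewrite mxE.
set w := eval_row iota l _ in nz e *.
have bc0 : b ^+ d * c ^+ d' != 0 by rewrite mulf_neq0 ?expf_neq0.
have w0 : map_mx phi w != 0 by rewrite map_mx_eq0.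
rewrite scaler_eq0 negb_or bc0 w0 => /(_ isT) e'.
apply/val_inj/val_inj; rewrite [RHS]e' {e'} /=.
have [a a0 sE] : exists2 a, a != 0 & coords (val (p + q)) = a *: w.
  have /vlineP[a sE] : coords (val (p + q)) \in <[w]>%VS.
    by rewrite -e; apply: memv_pick.
  exists a => //; apply: contraNneq (coords_neq0 (val (p + q))) => a0.
  by rewrite sE a0 scale0r.
by rewrite sE map_mxZ !vline_scale ?fmorph_eq0.
Qed.

Fact rational_points_map_is_nmod : nmod_morphism rational_points_map.
Proof.
split; last exact: rational_points_mapD.
by apply: (addIr (rational_points_map 0)); rewrite -rational_points_mapD !add0r.
Qed.

HB.instance Definition _ := GRing.isNmodMorphism.Build
  (rational_points iota) (rational_points iota') rational_points_map
  rational_points_map_is_nmod.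
End Functoriality.
End RationalPoints.

Section GaloisAction.
Variables (K : fieldExtType rat) (L : splittingFieldType K).
Variable A : abelianVariety K.

Fact gal_in_alg (s : gal_of {:L}) k : s (in_alg L k) = in_alg L k.
Proof. by rewrite /= linearZ /= rmorph1. Qed.

Definition galois_act (s : gal_of {:L}) :
    {additive rational_points A (in_alg L) -> rational_points A (in_alg L)} :=
  rational_points_map (gal_in_alg s).

Lemma galois_act1 p : galois_act 1%g p = p.
Proof.
apply/val_inj/val_inj; rewrite /= -[RHS]coordsK; congr (<[_]>%VS).
by apply/rowP => i; rewrite mxE gal_id.
Qed.

(* As always for 'Gal(_ / _) in MathComp, this is a right action *)
Lemma galois_actM s t p : galois_act (s * t)%g p = galois_act t (galois_act s p).
Proof.
apply/val_inj/val_inj => /=.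
pose phi : {rmorphism L -> L} := [the {rmorphism L -> L} of (s : L -> L)].
have [c c0 ->] := coords_base_change phi (val p).
rewrite map_mxZ vline_scale ?fmorph_eq0 //; congr (<[_]>%VS).
by apply/rowP => i; rewrite !mxE galM ?memvf.
Qed.
End GaloisAction.

(* Main.v *)
(* It suffices to find an elliptic curve A over a number field K, a Galois
   extension L / K with group G and points of A(L) which G permutes regularly and
   which are linearly independent, since V embeds in the regular representation.
   Embed G in S_p with p > #|G| prime, by Cayley. The curve is the Hesse cubic
   x^3 + y^3 + z^3 + 3xyz = 0, also given by 3 t^2 = w^3 + 3 w^2 + 24 w + 48. Its
   points with t = 1 / (2 prod_j (D w - 3 j)) are p points conjugate over Q: the
   polynomial of degree p for D w is irreducible, all of its roots having 2-adic
   valuation - 2 / p, and it has exactly two nonreal roots, so that its Galois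
   group is S_p. All these points are close to the neutral element at 2, where
   the group is torsion-free; hence the differences of any two of them are not
   torsion, and applying transpositions to a relation sum_i n_i P_i = 0 shows that
   all the n_i are equal. As the p points are more than #|G|, the points indexed
   by G are independent. One takes for K the fixed field of G. *)
From HB Require Import structures.
Require Import Defs.
From mathcomp Require Import all_boot all_order all_algebra all_fingroup all_field.
From mathcomp Require Import cyclic mxrepresentation boolp mpoly ring zify.
From mathcomp Require classical_sets.

Set Implicit Arguments.
Unset Strict Implicit.
Unset Printing Implicit Defensive.

Import Order.TTheory GRing.Theory Num.Theory.
Local Open Scope ring_scope.

(** * The group law of the Hesse cubic *)

Definition row3 (R : nzRingType) (x y z : R) : 'rV[R]_3 := \row_i [:: x; y; z]`_i.

Lemma row3_eta (R : nzRingType) (u : 'rV[R]_3) : row3 (u 0 0) (u 0 1) (u 0 2) = u.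
Proof.
by apply/rowP; case=> [[|[|[|//]]] lt]; rewrite mxE /=; congr (u 0 _); apply: val_inj.
Qed.

Lemma row3P (R : nzRingType) (u v : 'rV[R]_3) :
  u 0 0 = v 0 0 -> u 0 1 = v 0 1 -> u 0 2 = v 0 2 -> u = v.
Proof. by move=> e0 e1 e2; rewrite -[u]row3_eta -[v]row3_eta e0 e1 e2. Qed.

Lemma map_row3 (R S : nzRingType) (f : {rmorphism R -> S}) x y z :
  map_mx f (row3 x y z) = row3 (f x) (f y) (f z).
Proof. by apply: row3P; rewrite !mxE. Qed.

Lemma scale_row3 (R : nzRingType) (c x y z : R) :
  c *: row3 x y z = row3 (c * x) (c * y) (c * z).
Proof. by apply: row3P; rewrite !mxE. Qed.

Lemma row3_neq0 (R : nzRingType) (u : 'rV[R]_3) :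
  (u != 0) = [|| u 0 0 != 0, u 0 1 != 0 | u 0 2 != 0].
Proof.
rewrite -!negb_and; congr (~~ _).
apply/eqP/and3P => [->|[/eqP x0 /eqP y0 /eqP z0]]; first by rewrite !mxE eqxx.
by apply: row3P; rewrite !mxE.
Qed.

Lemma vline_eqP (F : fieldType) (V : vectType F) (u v : V) : v != 0 ->
  <[u]>%VS = <[v]>%VS -> exists2 c, c != 0 & u = c *: v.
Proof.
move=> v0 e; have /vlineP[c uE] : u \in <[v]>%VS by rewrite -e memv_line.
exists c => //; apply: contraNneq v0 => c0.
have : \dim <[u]> = \dim <[v]> by rewrite e.
by rewrite !dim_vline uE c0 scale0r eqxx; case: eqP.
Qed.

Definition parallel (R : nzRingType) n (u v : 'rV[R]_n) :=
  forall i j, u 0 i * v 0 j = u 0 j * v 0 i.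

Lemma parallel_vline (F : fieldType) n (u v : 'rV[F]_n) :
  u != 0 -> v != 0 -> parallel u v -> <[u]>%VS = <[v]>%VS.
Proof.
move=> u0 /rV0Pn[k vk] uv; have uE : u = (u 0 k / v 0 k) *: v.
  by apply/rowP => i; rewrite mxE mulrAC -uv mulfK.
rewrite uE vline_scale //; apply: contraNneq u0 => c0.
by rewrite uE c0 scale0r.
Qed.

Lemma parallel_row3 (R : comNzRingType) (u v : 'rV[R]_3) :
  u 0 0 * v 0 1 = u 0 1 * v 0 0 -> u 0 1 * v 0 2 = u 0 2 * v 0 1 ->
  u 0 2 * v 0 0 = u 0 0 * v 0 2 -> parallel u v.
Proof.
move=> e01 e12 e20 i j.
have I3 (k : 'I_3) : [\/ k = 0, k = 1 | k = 2].
  by case: k => [[|[|[|//]]] lt]; [constructor 1|constructor 2|constructor 3]; apply: val_inj.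
by case: (I3 i) (I3 j) => -> [] ->.
Qed.

(* The two addition laws of bidegree (2, 2) on the Hesse cubic with neutral
   element (1 : -1 : 0). The first one vanishes when p - q is one of the three
   points on z = 0; the second one is its translate by a point of order 3,
   which acts by cyclic permutation of the coordinates. *)
Section HesseCubic.
Variable R : comNzRingType.
Implicit Types u v w : 'rV[R]_3.

Definition hesse u :=
  u 0 0 ^+ 3 + u 0 1 ^+ 3 + u 0 2 ^+ 3 + 3 * u 0 0 * u 0 1 * u 0 2.

Definition hesse_law (b : bool) u v : 'rV[R]_3 :=
  let x1 := u 0 0 in let y1 := u 0 1 in let z1 := u 0 2 in
  let x2 := v 0 0 in let y2 := v 0 1 in let z2 := v 0 2 in
  if b then row3 (x1 ^+ 2 * x2 * y2 - z2 ^+ 2 * y1 * z1)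
                 (z1 ^+ 2 * x2 * z2 - y2 ^+ 2 * x1 * y1)
                 (y1 ^+ 2 * y2 * z2 - x2 ^+ 2 * x1 * z1)
  else row3 (y1 ^+ 2 * x2 * z2 - y2 ^+ 2 * x1 * z1)
            (x1 ^+ 2 * y2 * z2 - x2 ^+ 2 * y1 * z1)
            (z1 ^+ 2 * x2 * y2 - z2 ^+ 2 * x1 * y1).

Definition hesse_opp u : 'rV[R]_3 := row3 (u 0 1) (u 0 0) (u 0 2).

Definition hesse_zero : 'rV[R]_3 := row3 1 (-1) 0.

Lemma hesse_cube u : hesse u = 0 ->
  u 0 0 ^+ 3 = - u 0 1 ^+ 3 - u 0 2 ^+ 3 - 3 * u 0 0 * u 0 1 * u 0 2.
Proof. by rewrite /hesse => /eqP; rewrite -!addrA addr_eq0 => /eqP->; ring. Qed.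

Lemma hesse_zero_on : hesse hesse_zero = 0.
Proof. by rewrite /hesse /hesse_zero !mxE /=; ring. Qed.

Lemma hesse_opp_on u : hesse u = 0 -> hesse (hesse_opp u) = 0.
Proof. by move=> /hesse_cube e; rewrite /hesse !mxE /=; ring: e. Qed.

Lemma hesse_law_on b u v : hesse u = 0 -> hesse v = 0 -> hesse (hesse_law b u v) = 0.
Proof.
move=> /hesse_cube eu /hesse_cube ev.
by case: b; rewrite /hesse /hesse_law !mxE /=; ring: eu ev.
Qed.

Lemma hesse_law_parallel b c u v : hesse u = 0 -> hesse v = 0 ->
  parallel (hesse_law b u v) (hesse_law c u v).
Proof.
move=> /hesse_cube eu /hesse_cube ev.
by case: b c => [] []; apply: parallel_row3; rewrite !mxE /=; ring: eu ev.
Qed.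

Lemma hesse_lawC b c u v : hesse u = 0 -> hesse v = 0 ->
  parallel (hesse_law b u v) (hesse_law c v u).
Proof.
move=> /hesse_cube eu /hesse_cube ev.
by case: b c => [] []; apply: parallel_row3; rewrite !mxE /=; ring: eu ev.
Qed.

Lemma hesse_law0 b u : hesse u = 0 -> parallel (hesse_law b hesse_zero u) u.
Proof.
move=> /hesse_cube eu.
by case: b; apply: parallel_row3; rewrite !mxE /=; ring: eu.
Qed.

Lemma hesse_lawN b u : hesse u = 0 ->
  parallel (hesse_law b (hesse_opp u) u) hesse_zero.
Proof.
move=> /hesse_cube eu.
by case: b; apply: parallel_row3; rewrite !mxE /=; ring: eu.
Qed.

Lemma hesse_lawA a b c d u v w : hesse u = 0 -> hesse v = 0 -> hesse w = 0 ->
  parallel (hesse_law a u (hesse_law b v w)) (hesse_law c (hesse_law d u v) w).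
Proof.
move=> /hesse_cube eu /hesse_cube ev /hesse_cube ew.
by case: a b c d => [] [] [] []; apply: parallel_row3; rewrite !mxE /=; ring: eu ev ew.
Qed.

Lemma hesse_oppZ a u : hesse_opp (a *: u) = a *: hesse_opp u.
Proof. by rewrite /hesse_opp scale_row3 !mxE. Qed.

Lemma hesse_lawZ a b c u v :
  hesse_law c (a *: u) (b *: v) = (a ^+ 2 * b ^+ 2) *: hesse_law c u v.
Proof. by case: c; apply: row3P; rewrite !mxE /=; ring. Qed.

Lemma hesseZ a u : hesse (a *: u) = a ^+ 3 * hesse u.
Proof. by rewrite /hesse !mxE; ring. Qed.
End HesseCubic.

Section HesseMap.
Variables (R S : comNzRingType) (f : {rmorphism R -> S}).

Lemma map_hesse u : hesse (map_mx f u) = f (hesse u).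
Proof. by rewrite /hesse !mxE !rmorphD !rmorphXn !rmorphM rmorph_nat. Qed.

Lemma map_hesse_law b u v :
  map_mx f (hesse_law b u v) = hesse_law b (map_mx f u) (map_mx f v).
Proof.
by case: b; rewrite map_row3 /hesse_law !mxE !rmorphB !rmorphM ?rmorphXn.
Qed.

Lemma map_hesse_opp u : map_mx f (hesse_opp u) = hesse_opp (map_mx f u).
Proof. by rewrite map_row3 /hesse_opp !mxE. Qed.

Lemma map_hesse_zero : map_mx f (hesse_zero R) = hesse_zero S.
Proof. by rewrite map_row3 rmorph1 rmorphN1 rmorph0. Qed.
End HesseMap.
Section HesseComplete.
Variable F : fieldType.
Implicit Types u v : 'rV[F]_3.

Lemma cube_sum0 (y z : F) : y ^+ 3 + z ^+ 3 = 0 -> y * z = 0 -> y = 0 /\ z = 0.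
Proof.
move=> e /eqP; rewrite mulf_eq0 => /orP[] /eqP z0; move: e; rewrite z0 expr0n.
  by rewrite add0r => /eqP; rewrite expf_eq0 => /eqP.
by rewrite addr0 => /eqP; rewrite expf_eq0 => /eqP.
Qed.

Let zero_case (x1 y1 z1 x2 y2 z2 : F) :
  x1 ^+ 3 + y1 ^+ 3 + z1 ^+ 3 + 3 * x1 * y1 * z1 = 0 ->
  x2 ^+ 3 + y2 ^+ 3 + z2 ^+ 3 + 3 * x2 * y2 * z2 = 0 ->
  x1 ^+ 2 * y2 * z2 = x2 ^+ 2 * y1 * z1 ->
  y1 ^+ 2 * y2 * z2 = x2 ^+ 2 * x1 * z1 ->
  x1 * x2 = 0 -> [/\ x1 = 0, y1 = 0 & z1 = 0] \/ [/\ x2 = 0, y2 = 0 & z2 = 0].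
Proof.
move=> h1 h2 e g x12.
have [x10|x10] := eqVneq x1 0.
  have h : y1 ^+ 3 + z1 ^+ 3 = 0 by move: h1; rewrite x10 => <-; ring.
  have [|yz] := eqVneq (y1 * z1) 0; first by case/(cube_sum0 h); left.
  have x20 : x2 = 0.
    move/eqP: e; rewrite x10 expr0n !mul0r eq_sym -mulrA mulf_eq0 (negPf yz) orbF.
    by rewrite expf_eq0 => /eqP.
  right; suff [-> ->] : y2 = 0 /\ z2 = 0 by [].
    apply: cube_sum0; first by move: h2; rewrite x20 => <-; ring.
  apply/eqP; move/eqP: g; rewrite x20 expr0n !mul0r -mulrA mulf_eq0.
  by rewrite expf_eq0 /=; move: yz; rewrite mulf_eq0 negb_or => /andP[/negPf->].
have x20 : x2 = 0 by apply/eqP; move/eqP: x12; rewrite mulf_eq0 (negPf x10).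
right; suff [-> ->] : y2 = 0 /\ z2 = 0 by [].
apply: cube_sum0; first by move: h2; rewrite x20 => <-; ring.
apply/eqP; move/eqP: e; rewrite x20 expr0n !mul0r -mulrA mulf_eq0.
by rewrite expf_eq0 /= (negPf x10).
Qed.

Lemma hesse_law_complete u v : 6%:R != 0 :> F -> u != 0 -> v != 0 ->
  hesse u = 0 -> hesse v = 0 ->
  hesse_law false u v = 0 -> hesse_law true u v != 0.
Proof.
move=> six u0 v0; rewrite /hesse => hu hv /rowP law0; apply/eqP => /rowP law1.
have := law0 0; have := law0 1; have := law0 2.
have := law1 0; have := law1 1; have := law1 2.
rewrite !mxE /= => /subr0_eq g2 /subr0_eq g1 /subr0_eq g0.
move=> /subr0_eq e2 /subr0_eq e1 /subr0_eq e0 {law0 law1}.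
move: u0 v0; rewrite !row3_neq0 => u0 v0.
move: (u 0 0) (u 0 1) (u 0 2) (v 0 0) (v 0 1) (v 0 2) hu hv g2 g1 g0 e2 e1 e0 u0 v0.
move=> x1 y1 z1 x2 y2 z2 hu hv g2 g1 g0 e2 e1 e0 u0 v0.
have x12 : x1 * x2 != 0.
  by apply/eqP => /(zero_case hu hv e1 g2)[] [e e' e'']; rewrite e e' e'' eqxx in u0 v0.
have y12 : y1 * y2 != 0.
  apply/eqP => /(@zero_case y1 z1 x1 y2 z2 x2)[].
  - by rewrite -[RHS]hu; ring.
  - by rewrite -[RHS]hv; ring.
  - by transitivity (y1 ^+ 2 * x2 * z2); [ring | rewrite e0; ring].
  - by transitivity (z1 ^+ 2 * x2 * z2); [ring | rewrite g1; ring].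
  - by case=> e e' e''; rewrite e e' e'' eqxx in u0.
  - by case=> e e' e''; rewrite e e' e'' eqxx in v0.
have z12 : z1 * z2 != 0.
  apply/eqP => /(@zero_case z1 x1 y1 z2 x2 y2)[].
  - by rewrite -[RHS]hu; ring.
  - by rewrite -[RHS]hv; ring.
  - by rewrite e2; ring.
  - by rewrite g0; ring.
  - by case=> e e' e''; rewrite e e' e'' eqxx in u0.
  - by case=> e e' e''; rewrite e e' e'' eqxx in v0.
have m0 : x2 * y2 * z2 != 0.
  by move: x12 y12 z12; rewrite !mulf_eq0 !negb_or => /andP[_ ->] /andP[_ ->] /andP[_ ->].
have x10 : x1 != 0 by move: x12; rewrite mulf_eq0 negb_or => /andP[].
have xz : x1 ^+ 3 = z1 ^+ 3.
  apply: (mulIf m0); transitivity (z2 ^+ 3 * (x1 * y1 * z1)).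
    by transitivity (x1 ^+ 2 * x2 * y2 * (x1 * z2)); [ring|rewrite g0; ring].
  by transitivity (z2 ^+ 2 * x1 * y1 * (z1 * z2)); [ring|rewrite -e2; ring].
have yz : y1 ^+ 3 = z1 ^+ 3.
  apply: (mulIf m0); transitivity (y2 ^+ 3 * (x1 * y1 * z1)).
    by transitivity (y1 ^+ 2 * x2 * z2 * (y1 * y2)); [ring|rewrite e0; ring].
  by transitivity (y2 ^+ 2 * x1 * y1 * (z1 * y2)); [ring|rewrite -g1; ring].
have three : 3%:R != 0 :> F by apply: contraNneq six => e; rewrite (natrM _ 2 3) e mulr0.
have two : 2%:R != 0 :> F by apply: contraNneq six => e; rewrite (natrM _ 2 3) e mul0r.
have m1 : x1 * y1 * z1 = - z1 ^+ 3.
  apply: (mulfI three); move: hu; rewrite xz yz => /eqP.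
  by rewrite addr_eq0 => /eqP e; rewrite -[LHS]opprK !mulrA -e; ring.
have : (2%:R * z1 ^+ 9) == 0.
  apply/eqP; transitivity (x1 ^+ 3 * y1 ^+ 3 * z1 ^+ 3 + (z1 ^+ 3) ^+ 3).
    by rewrite xz yz; ring.
  by rewrite -!exprMn m1; ring.
rewrite mulf_eq0 (negPf two) expf_eq0 /= => /eqP z0.
by move: z12; rewrite z0 mul0r eqxx.
Qed.
End HesseComplete.

Section HessePoints.
Variable F : fieldType.
Implicit Types (p q r : projpt F 2) (u v w : 'rV[F]_3).

Definition on_hesse p := hesse (coords p) == 0.

Definition vline_pt p u : projpt F 2 := insubd p <[u]>%VS.

(* hesse_add and hesse_neg take junk values off the curve *)
Definition hesse_add p q : projpt F 2 :=
  let w := hesse_law false (coords p) (coords q) in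
  vline_pt p (if w == 0 then hesse_law true (coords p) (coords q) else w).

Definition hesse_neg p : projpt F 2 := vline_pt p (hesse_opp (coords p)).

Lemma val_vline_pt p u : u != 0 -> val (vline_pt p u) = <[u]>%VS.
Proof. by move=> u0; rewrite val_insubd dim_vline u0. Qed.

Lemma on_hesse_vline p u : u != 0 -> val p = <[u]>%VS -> on_hesse p = (hesse u == 0).
Proof.
move=> u0; rewrite -coordsK => /(vline_eqP u0)[c c0 e].
by rewrite /on_hesse e hesseZ mulf_eq0 expf_eq0 /= (negPf c0).
Qed.

Lemma hesse_opp_neq0 u : u != 0 -> hesse_opp u != 0.
Proof. by rewrite !row3_neq0 !mxE /= orbCA. Qed.

Hypothesis six : 6%:R != 0 :> F.

Lemma hesse_law_exists u v : u != 0 -> v != 0 -> hesse u = 0 -> hesse v = 0 ->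
  exists b, hesse_law b u v != 0.
Proof.
move=> u0 v0 hu hv; have [e|] := eqVneq (hesse_law false u v) 0; last by exists false.
by exists true; apply: hesse_law_complete.
Qed.

Lemma val_hesse_add b p q u v : on_hesse p -> on_hesse q ->
  val p = <[u]>%VS -> val q = <[v]>%VS -> hesse_law b u v != 0 ->
  val (hesse_add p q) = <[hesse_law b u v]>%VS.
Proof.
move=> /eqP hp /eqP hq pu qv w0.
have u0 : u != 0.
  apply: contraNneq w0 => ->; have := hesse_lawZ 0 1 b 0 v.
  by rewrite scaler0 scale1r expr0n mul0r scale0r => ->.
have v0 : v != 0.
  apply: contraNneq w0 => ->; have := hesse_lawZ 1 0 b u 0.
  by rewrite scaler0 scale1r expr0n mulr0 scale0r => ->.
have [a a0 pE] : exists2 a, a != 0 & coords p = a *: u.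
  by apply: vline_eqP => //; rewrite coordsK.
have [c c0 qE] : exists2 c, c != 0 & coords q = c *: v.
  by apply: vline_eqP => //; rewrite coordsK.
have ac0 : a ^+ 2 * c ^+ 2 != 0 by rewrite mulf_neq0 ?expf_neq0.
have hu : hesse u = 0 by apply/eqP; rewrite -(on_hesse_vline u0 pu) /on_hesse hp.
have hv : hesse v = 0 by apply/eqP; rewrite -(on_hesse_vline v0 qv) /on_hesse hq.
rewrite /hesse_add pE qE !hesse_lawZ; set w := if _ then _ else _.
have [s wE ws] : exists2 s, w = (a ^+ 2 * c ^+ 2) *: hesse_law s u v & w != 0.
  rewrite /w; have [e|w'0] := eqVneq; last by exists false.
  exists true => //; rewrite scaler_eq0 (negPf ac0) /=; apply: hesse_law_complete => //.
  by move/eqP: e; rewrite scaler_eq0 (negPf ac0) => /eqP.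
rewrite val_vline_pt // wE vline_scale //; apply: parallel_vline => //.
  by move: ws; rewrite wE scaler_eq0 negb_or => /andP[].
exact: hesse_law_parallel.
Qed.

Lemma hesse_addE p q : on_hesse p -> on_hesse q -> exists2 b,
  hesse_law b (coords p) (coords q) != 0 &
  val (hesse_add p q) = <[hesse_law b (coords p) (coords q)]>%VS.
Proof.
move=> hp hq.
have [b w0] := hesse_law_exists (coords_neq0 p) (coords_neq0 q) (eqP hp) (eqP hq).
by exists b; rewrite // (val_hesse_add hp hq _ _ w0) ?coordsK.
Qed.

Lemma val_hesse_neg p u : u != 0 -> val p = <[u]>%VS ->
  val (hesse_neg p) = <[hesse_opp u]>%VS.
Proof.
move=> u0 pu; have [c c0 e] : exists2 c, c != 0 & coords p = c *: u.
  by apply: vline_eqP => //; rewrite coordsK.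
have ou0 : hesse_opp u != 0 by apply: hesse_opp_neq0.
by rewrite val_vline_pt ?e hesse_oppZ ?vline_scale // scaler_eq0 negb_or c0.
Qed.

Lemma hesse_add_on p q : on_hesse p -> on_hesse q -> on_hesse (hesse_add p q).
Proof.
move=> hp hq; have [b w0 e] := hesse_addE hp hq.
by rewrite (on_hesse_vline w0 e) (hesse_law_on _ (eqP hp) (eqP hq)).
Qed.

Lemma hesse_neg_on p : on_hesse p -> on_hesse (hesse_neg p).
Proof.
move=> hp; have := val_hesse_neg (coords_neq0 p) (esym (coordsK p)).
move/(on_hesse_vline (hesse_opp_neq0 (coords_neq0 p)))->.
by rewrite hesse_opp_on // (eqP hp).
Qed.

Lemma hesse_addC p q : on_hesse p -> on_hesse q -> hesse_add p q = hesse_add q p.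
Proof.
move=> hp hq; have [b w0 e] := hesse_addE hp hq; have [c w'0 e'] := hesse_addE hq hp.
by apply/val_inj; rewrite e e'; apply/parallel_vline/hesse_lawC/eqP/hq/eqP.
Qed.

Lemma hesse_addA p q r : on_hesse p -> on_hesse q -> on_hesse r ->
  hesse_add p (hesse_add q r) = hesse_add (hesse_add p q) r.
Proof.
move=> hp hq hr; have [b w0 e] := hesse_addE hq hr; have [d w'0 e'] := hesse_addE hp hq.
have hqr := hesse_add_on hq hr; have hpq := hesse_add_on hp hq.
have [a a0] := hesse_law_exists (coords_neq0 p) w0 (eqP hp) (hesse_law_on b (eqP hq) (eqP hr)).
have [c c0] := hesse_law_exists w'0 (coords_neq0 r) (hesse_law_on d (eqP hp) (eqP hq)) (eqP hr).
apply/val_inj; rewrite (val_hesse_add hp hqr (esym (coordsK p)) e a0).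
rewrite (val_hesse_add hpq hr e' (esym (coordsK r)) c0).
by apply: parallel_vline => //; apply: hesse_lawA; apply/eqP.
Qed.

Lemma hesse_zero_neq0 : hesse_zero F != 0.
Proof. by rewrite row3_neq0 !mxE oner_neq0. Qed.

Lemma hesse_add0 o p : val o = <[hesse_zero F]>%VS -> on_hesse p -> hesse_add o p = p.
Proof.
move=> oE hp; have ho : on_hesse o.
  by rewrite (on_hesse_vline hesse_zero_neq0 oE) hesse_zero_on.
have [b b0] := hesse_law_exists hesse_zero_neq0 (coords_neq0 p) (hesse_zero_on F) (eqP hp).
apply/val_inj; rewrite (val_hesse_add ho hp oE (esym (coordsK p)) b0).
by rewrite -[RHS]coordsK; apply: parallel_vline; rewrite ?coords_neq0 //; apply/hesse_law0/eqP.
Qed.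

Lemma hesse_addN o p : val o = <[hesse_zero F]>%VS -> on_hesse p ->
  hesse_add (hesse_neg p) p = o.
Proof.
move=> oE hp; have hn := hesse_neg_on hp; have p0 := coords_neq0 p.
have nE := val_hesse_neg p0 (esym (coordsK p)).
have [b b0] := hesse_law_exists (hesse_opp_neq0 p0) p0 (hesse_opp_on (eqP hp)) (eqP hp).
apply/val_inj; rewrite oE (val_hesse_add hn hp nE (esym (coordsK p)) b0).
by apply: parallel_vline; rewrite ?hesse_zero_neq0 //; apply/hesse_lawN/eqP.
Qed.
End HessePoints.
(** * Irreducibility of the Hesse cubic *)

Lemma closed_poly_eq0 (F : closedFieldType) (p : {poly F}) :
  (forall x, p.[x] = 0) -> p = 0.
Proof.
move=> p0; have [/size1_polyC pE|p_gt1] := leqP (size p) 1.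
  by have := p0 0; rewrite {1}pE hornerC => e; rewrite pE e.
have /closed_rootP[x] : size (p + 1) != 1.
  by rewrite size_polyDl ?size_poly1 // neq_ltn p_gt1 orbT.
by rewrite /root hornerD p0 hornerC add0r oner_eq0.
Qed.

Section MonicCubic.
Variable R : nzRingType.
Implicit Types a b c x : R.

Definition cubic_poly a b c : {poly R} := 'X^3 + a%:P * 'X^2 + b%:P * 'X + c%:P.

Lemma size_cubic_poly a b c : size (cubic_poly a b c) = 4.
Proof.
rewrite /cubic_poly -!addrA size_polyDl ?size_polyXn //.
apply: leq_ltn_trans (size_polyD _ _) _; rewrite gtn_max; apply/andP; split.
  by apply: leq_ltn_trans (size_polyMleq _ _) _; rewrite size_polyXn size_polyC; case: eqP.
apply: leq_ltn_trans (size_polyD _ _) _; rewrite gtn_max; apply/andP; split.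
  by apply: leq_ltn_trans (size_polyMleq _ _) _; rewrite size_polyX size_polyC; case: eqP.
by rewrite size_polyC; case: eqP.
Qed.

Lemma cubic_poly_monic a b c : cubic_poly a b c \is monic.
Proof.
rewrite monicE lead_coefE size_cubic_poly /cubic_poly.
by rewrite !(coefD, coefMX, coefCM, coefXn, coefX, coefC) /= !mulr0 !addr0.
Qed.

Lemma horner_cubic_poly a b c x :
  (cubic_poly a b c).[x] = x ^+ 3 + a * x ^+ 2 + b * x + c.
Proof.
by rewrite /cubic_poly !(hornerD, hornerCM, hornerXn, hornerX, hornerC).
Qed.
End MonicCubic.

Lemma map_cubic_poly (R S : nzRingType) (f : {rmorphism R -> S}) a b c :
  map_poly f (cubic_poly a b c) = cubic_poly (f a) (f b) (f c).
Proof.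
apply/polyP => i; rewrite coef_map /= /cubic_poly !coefD !coefCM !coefXn !coefX !coefC.
by rewrite !rmorphD !rmorphM !rmorph_nat (fun_if f) rmorph0.
Qed.

(* The affine chart of the Hesse cubic given by the degree 2 map w, ramified at
   the flex (1 : -1 : 0) *)
Section HesseChart.
Variable F : fieldType.
Implicit Types (w t : F) (u : 'rV[F]_3).

Definition chart_poly : {poly F} := cubic_poly 3 24 48.

Definition chart_rel w t := 3 * t ^+ 2 == chart_poly.[w].

Definition chart w t : 'rV[F]_3 := row3 (4 - w + t) (4 - w - t) (- (8 + 2 * w)).

Lemma chart_polyE w : chart_poly.[w] = w ^+ 3 + 3 * w ^+ 2 + 24 * w + 48.
Proof. exact: horner_cubic_poly. Qed.

Lemma chart_on w t : chart_rel w t -> hesse (chart w t) = 0.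
Proof.
rewrite /chart_rel chart_polyE => /eqP e; rewrite /hesse !mxE /=.
transitivity (16 * (3 * t ^+ 2 - (w ^+ 3 + 3 * w ^+ 2 + 24 * w + 48))); first by ring.
by rewrite e subrr mulr0.
Qed.

Hypothesis six : 6%:R != 0 :> F.

Let two : 2%:R != 0 :> F.
Proof. by apply: contraNneq six => e; rewrite (natrM _ 2 3) e mul0r. Qed.

Let three : 3%:R != 0 :> F.
Proof. by apply: contraNneq six => e; rewrite (natrM _ 2 3) e mulr0. Qed.

Lemma chart_neq0 w t : chart w t != 0.
Proof.
apply/eqP => /rowP c0; case/eqP: (expf_neq0 4 two); rewrite -natrX.
transitivity (chart w t 0 0 + chart w t 0 1 - chart w t 0 2).
  by rewrite !mxE /=; ring.
by rewrite !c0 !mxE subr0 addr0.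
Qed.

Lemma hesse_tangent u : hesse u = 0 -> u 0 0 + u 0 1 = u 0 2 ->
  u 0 2 = 0 /\ u 0 1 = - u 0 0.
Proof.
move=> hu e; have z0 : u 0 2 = 0.
  have : 2%:R * u 0 2 ^+ 3 = 0 by rewrite -hu /hesse -e; ring.
  by move/eqP; rewrite mulf_eq0 (negPf two) expf_eq0 => /eqP.
by split=> //; apply/eqP; rewrite -addr_eq0 addrC e z0.
Qed.

Lemma hesse_chart u : u != 0 -> hesse u = 0 ->
  (exists2 c, c != 0 & u = c *: hesse_zero F) \/
  exists w t c, [/\ c != 0, chart_rel w t & u = c *: chart w t].
Proof.
move=> u0 hu; have [|s0] := eqVneq (u 0 0 + u 0 1) (u 0 2).
  case/(hesse_tangent hu) => z0 y0; left.
  have uE : u = u 0 0 *: hesse_zero F.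
    by rewrite scale_row3 mulr1 mulrN1 mulr0 -y0 -[in RHS]z0 row3_eta.
  exists (u 0 0) => //; apply: contraNneq u0 => c0.
  by rewrite uE c0 scale0r.
right; set s := u 0 0 + u 0 1 - u 0 2.
have {}s0 : s != 0 by rewrite subr_eq0.
pose w := (- (u 0 0 + u 0 1) - u 0 2) * 4 / s; pose t := (u 0 0 - u 0 1) * 8 / s.
have sixteen : 16%:R != 0 :> F by rewrite (natrX _ 2 4) expf_neq0.
have c0 : s / 16%:R != 0 by rewrite mulf_neq0 ?invr_eq0.
have uE : u = (s / 16%:R) *: chart w t.
  apply: row3P; rewrite !mxE /= /w /t; move: s0; rewrite /s => s0; field; rewrite ?s0 ?sixteen //.
exists w, t, (s / 16%:R); split=> //.
have : hesse (chart w t) = 0.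
  move/eqP: hu; rewrite uE hesseZ mulf_eq0 expf_eq0 /= (negPf c0) => /eqP //.
rewrite /hesse !mxE /= => e; rewrite /chart_rel -subr_eq0.
rewrite -(mulrI_eq0 _ (mulfI sixteen)); apply/eqP; rewrite -e chart_polyE.
ring.
Qed.

(* Modulo 3 t^2 = chart_poly.[w], every polynomial in w and t is linear in t *)
Definition chart_linear (f : F -> F -> F) :=
  exists a b : {poly F}, forall w t, chart_rel w t -> f w t = a.[w] + b.[w] * t.

Lemma chart_linearD f g : chart_linear f -> chart_linear g ->
  chart_linear (fun w t => f w t + g w t).
Proof.
move=> [a [b fE]] [c [d gE]]; exists (a + c), (b + d) => w t e.
by rewrite fE // gE // !hornerD; ring.
Qed.

Lemma chart_linearM f g : chart_linear f -> chart_linear g ->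
  chart_linear (fun w t => f w t * g w t).
Proof.
move=> [a [b fE]] [c [d gE]].
exists (a * c + b * d * (3%:R^-1 *: chart_poly)), (a * d + b * c) => w t e.
rewrite fE // gE //; move/eqP: e; move: chart_poly => q e.
by rewrite !(hornerD, hornerM, hornerZ) -e; field.
Qed.

Lemma chart_linearC c : chart_linear (fun _ _ => c).
Proof. by exists c%:P, 0 => w t _; rewrite hornerC horner0 mul0r addr0. Qed.

Lemma chart_linear_mmap (f : {mpoly F[3]}) (h : F -> F -> 'rV[F]_3) :
  (forall i, chart_linear (fun w t => h w t 0 i)) ->
  chart_linear (fun w t => mmap idfun (h w t 0) f).
Proof.
move=> hlin; rewrite /mmap; elim: (msupp f) => [|m s IHs].
  by under eq_fun do under eq_fun do rewrite big_nil; apply: chart_linearC.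
under eq_fun do under eq_fun do rewrite big_cons.
apply: chart_linearD => //; apply: chart_linearM; first exact: chart_linearC.
rewrite /mmap1; elim: (index_enum _) => [|i r IHr].
  by under eq_fun do under eq_fun do rewrite big_nil; apply: chart_linearC.
under eq_fun do under eq_fun do rewrite big_cons.
apply: chart_linearM => //; elim: (m i) => [|k IHk].
  by under eq_fun do under eq_fun do rewrite expr0; apply: chart_linearC.
by under eq_fun do under eq_fun do rewrite exprS; apply: chart_linearM.
Qed.

Lemma chart_linear_coord i : chart_linear (fun w t => chart w t 0 i).
Proof.
rewrite /chart /row3; case: i => [[|[|[|//]]] lt].
- by exists (4%:P - 'X), 1 => w t _; rewrite !mxE !hornerE.
- by exists (4%:P - 'X), (- 1) => w t _; rewrite !mxE !hornerE /=; ring.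
- by exists (- (8%:P + 2%:P * 'X)), 0 => w t _; rewrite !mxE !hornerE.
Qed.

Lemma chart_norm_eq0 (a b : {poly F}) :
  a ^+ 2 = b ^+ 2 * (3%:R^-1 *: chart_poly) -> a = 0 /\ b = 0.
Proof.
move=> e; suff b0 : b = 0.
  by split=> //; apply/eqP; move/eqP: e; rewrite b0 expr0n mul0r expf_eq0.
apply/eqP/negPn/negP => b0.
have three' : 3%:R^-1 != 0 :> F by rewrite invr_eq0.
have q0 : 3%:R^-1 *: chart_poly != 0.
  by rewrite scaler_eq0 negb_or three' -size_poly_eq0 size_cubic_poly.
have a0 : a != 0.
  apply: contraNneq b0 => a0; move/esym/eqP: e.
  by rewrite a0 expr0n mulf_eq0 (negPf q0) orbF expf_eq0.
have szq : size (3%:R^-1 *: chart_poly) = 4 by rewrite size_scale // size_cubic_poly.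
move: (3%:R^-1 *: chart_poly) q0 szq e => q q0 szq.
move/(congr1 (fun p : {poly F} => odd (size p))).
rewrite !expr2 [size (a * a)]size_mul // (size_mul (mulf_neq0 b0 b0) q0) szq size_mul //.
move: a0 b0; rewrite -!size_poly_gt0.
case: (size a) (size b) => [|m] [|n] //= _ _; rewrite !addnS !addSn /= !oddD.
by rewrite /= !addbb.
Qed.
End HesseChart.

Section HesseIrreducible.
Variable F : closedFieldType.
Hypothesis six : 6%:R != 0 :> F.

Lemma chart_rel_exists w : exists t : F, chart_rel w t.
Proof.
have three : 3%:R != 0 :> F by apply: contraNneq six => e; rewrite (natrM _ 2 3) e mulr0.
have /closed_rootP[t] : size ('X^2 - ((chart_poly F).[w] / 3%:R)%:P) != 1.
  by rewrite size_XnsubC.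
rewrite /root hornerD hornerN hornerXn hornerC subr_eq0 => /eqP e; exists t.
by rewrite /chart_rel e mulrC divfK.
Qed.

Lemma chart_linear_mul_eq0 (a b c d : {poly F}) w0 :
  (forall w t, w != w0 -> chart_rel w t -> (a.[w] + b.[w] * t) * (c.[w] + d.[w] * t) = 0) ->
  (a = 0 /\ b = 0) \/ (c = 0 /\ d = 0).
Proof.
have three : 3%:R != 0 :> F by apply: contraNneq six => e; rewrite (natrM _ 2 3) e mulr0.
move=> vanish; pose q : {poly F} := 3%:R^-1 *: chart_poly F.
have /eqP : (a ^+ 2 - b ^+ 2 * q) * (c ^+ 2 - d ^+ 2 * q) * ('X - w0%:P) = 0.
  apply: closed_poly_eq0 => w; have [t wt] := chart_rel_exists w.
  have [->|ww0] := eqVneq w w0; first by rewrite hornerM hornerXsubC subrr mulr0.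
  have qt : q.[w] = t ^+ 2 by rewrite hornerZ -(eqP wt) mulKf.
  have wt' : chart_rel w (- t) by rewrite /chart_rel sqrrN.
  move: q qt => q qt; rewrite !(hornerM, hornerD, hornerN, horner_exp, hornerX, hornerC) qt.
  transitivity (((a.[w] + b.[w] * t) * (c.[w] + d.[w] * t)) *
     ((a.[w] + b.[w] * - t) * (c.[w] + d.[w] * - t)) * ('X - w0%:P).[w]).
    by rewrite hornerXsubC; ring.
  by rewrite vanish // mul0r mul0r.
rewrite !mulf_eq0 polyXsubC_eq0 orbF !subr_eq0 => /orP[] /eqP /(chart_norm_eq0 six);
  by [left|right].
Qed.

Definition hesse_rot (R : nzRingType) (u : 'rV[R]_3) := row3 (u 0 1) (u 0 2) (u 0 0).

Lemma hesse_chart_all (f : {mpoly F[3]}) d : f \is d.-homog ->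
  (forall w t, chart_rel w t -> mmap idfun (chart w t 0) f = 0) ->
  forall u, u != 0 -> hesse u = 0 -> mmap idfun (u 0) f = 0.
Proof.
have mmapZ c (u : 'rV[F]_3) (g : {mpoly F[3]}) e : g \is e.-homog ->
    mmap idfun ((c *: u) 0) g = c ^+ e * mmap idfun (u 0) g.
  move=> ge; rewrite -(mmap_dhomog idfun _ c ge); apply: mmap_eq => i.
  by rewrite mxE.
move=> fd f0; suff fO : mmap idfun (hesse_zero F 0) f = 0.
  move=> u u0 /(hesse_chart six u0)[[c _ ->]|[w [t [c [_ wt ->]]]]].
    by rewrite (mmapZ _ _ _ _ fd) fO mulr0.
  by rewrite (mmapZ _ _ _ _ fd) f0 ?mulr0.
have two : 2%:R != 0 :> F by apply: contraNneq six => e; rewrite (natrM _ 2 3) e mul0r.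
have eight : 8%:R != 0 :> F by rewrite (natrX _ 2 3) expf_neq0.
pose g w t := mmap idfun (hesse_rot (chart w t) 0) f.
have [a [b gE]] : chart_linear g.
  apply: chart_linear_mmap => // i; have := @chart_linear_coord F.
  rewrite /hesse_rot /row3 => lin; case: i => [[|[|[|//]]] lt].
  - by under eq_fun do under eq_fun do rewrite mxE /=; apply: lin.
  - by under eq_fun do under eq_fun do rewrite mxE /=; apply: lin.
  - by under eq_fun do under eq_fun do rewrite mxE /=; apply: lin.
have g0 w t : w != 0 -> chart_rel w t -> g w t = 0.
  move=> w0 wt; rewrite /g; set u := hesse_rot _.
  have hu : hesse u = 0 by rewrite -(chart_on wt) /u /hesse !mxE /=; ring.
  have u0 : u != 0.
    rewrite row3_neq0 !mxE /= -!negb_and; apply/negP => /and3P[/eqP y0 /eqP z0 /eqP x0].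
    case/eqP: (expf_neq0 4 two); rewrite -natrX.
    transitivity ((4 - w - t) + (4 - w + t) - (- (8 + 2 * w))); first by ring.
    by rewrite x0 y0 z0 add0r subr0.
  have [[c c0 uE]|[w' [t' [c [_ wt' ->]]]]] := hesse_chart six u0 hu; last first.
    by rewrite (mmapZ _ _ _ _ fd) f0 ?mulr0.
  case/eqP: (mulf_neq0 (expf_neq0 2 two) w0); rewrite -natrX.
  transitivity (- (u 0 0 + u 0 1 + u 0 2)); first by rewrite !mxE /=; ring.
  by rewrite uE !mxE /=; ring.
have [[a0 b0]|[/eqP]] : (a = 0 /\ b = 0) \/ ((1 : {poly F}) = 0 /\ (0 : {poly F}) = 0).
- apply: (@chart_linear_mul_eq0 _ _ _ _ 0) => w t w0 wt.
  by rewrite -gE // g0 // mul0r.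
- have : g 0 (- 4) = 0.
    rewrite gE ?a0 ?b0 ?horner0 ?mul0r ?addr0 //.
    by rewrite /chart_rel chart_polyE; apply/eqP; ring.
  rewrite /g; have -> : hesse_rot (chart 0 (- 4)) = 8%:R *: hesse_zero F.
    by apply: row3P; rewrite !mxE /=; ring.
  rewrite (mmapZ _ _ _ _ fd) => /eqP; rewrite mulf_eq0 expf_eq0 (negPf eight) andbF.
  by move=> /eqP.
by rewrite oner_eq0.
Qed.
End HesseIrreducible.
(** * The Hesse cubic as an abelian variety *)

Lemma char0_nat (K : fieldExtType rat) (F : fieldType) (iota : {rmorphism K -> F}) n :
  n.+1%:R != 0 :> F.
Proof.
rewrite -(rmorph_nat iota) fmorph_eq0 -(rmorph_nat (in_alg K)) fmorph_eq0.
by rewrite pnatr_eq0.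
Qed.

Lemma val_proj_class (F : fieldType) n (v : 'rV[F]_n.+1) (v0 : v != 0) :
  val (proj_class v0) = <[v]>%VS.
Proof. by []. Qed.

Section HesseVariety.
Variable K : fieldExtType rat.

Definition hesse_poly : {mpoly K[3]} := hesse (\row_i 'X_i).

Lemma hesse_poly_homog : hesse_poly \is 3.-homog.
Proof.
have h1 i : 'X_i \is [in K[3], 1.-homog] by rewrite dhomogX /= mdeg1.
have h3 i : 'X_i ^+ 3 \is [in K[3], 3.-homog] by exact: dhomogMn (h1 i).
rewrite /hesse_poly /hesse !mxE !rpredD //.
rewrite -!mulrA mulr_natl rpredMn //.
exact: dhomogM (h1 _) (dhomogM (h1 _) (h1 _)).
Qed.

Lemma hesse_equations_homog f : f \in [:: hesse_poly] -> homogeneous f.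
Proof. by rewrite inE => /eqP ->; exists 3%N; apply: hesse_poly_homog. Qed.

Definition hesse_set : closedSet K 2 := ClosedSet hesse_equations_homog.

Lemma mmap_row (F : fieldType) (iota : {rmorphism K -> F}) n (u : 'rV[F]_n) :
  map_mx (mmap iota (u 0)) (\row_i 'X_i) = u.
Proof. by apply/rowP => i; rewrite !mxE mmapX mmap1U. Qed.

Section Points.
Variables (F : fieldType) (iota : {rmorphism K -> F}).

Lemma on_hesse_set (p : projpt F 2) : on iota hesse_set p = on_hesse p.
Proof.
by rewrite /on /= andbT /on_hesse -[in RHS](mmap_row iota (coords p)) map_hesse.
Qed.

Let six : 6%:R != 0 :> F := char0_nat iota 5.

Lemma points_on_hesse (p : points iota hesse_set) : on_hesse (val p).
Proof. by rewrite -on_hesse_set (valP p). Qed.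

Fact hesse_pt_add_subproof (p q : points iota hesse_set) :
  on iota hesse_set (hesse_add (val p) (val q)).
Proof. by rewrite on_hesse_set hesse_add_on ?points_on_hesse. Qed.

Definition hesse_pt_add p q : points iota hesse_set :=
  exist _ (hesse_add (val p) (val q)) (hesse_pt_add_subproof p q).

Fact hesse_pt_opp_subproof (p : points iota hesse_set) :
  on iota hesse_set (hesse_neg (val p)).
Proof. by rewrite on_hesse_set hesse_neg_on ?points_on_hesse. Qed.

Definition hesse_pt_opp p : points iota hesse_set :=
  exist _ (hesse_neg (val p)) (hesse_pt_opp_subproof p).
End Points.

Fact hesse_pt_zero_subproof :
  on idfun hesse_set (proj_class (hesse_zero_neq0 K)).
Proof.
by rewrite on_hesse_set (on_hesse_vline (hesse_zero_neq0 K) (val_proj_class _)) hesse_zero_on.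
Qed.

Definition hesse_pt_zero : points (idfun : K -> K) hesse_set :=
  exist _ (proj_class (hesse_zero_neq0 K)) hesse_pt_zero_subproof.

Lemma val_hesse_zero (F : fieldType) (iota : {rmorphism K -> F}) :
  val (val (constant_point iota hesse_pt_zero)) = <[hesse_zero F]>%VS.
Proof.
rewrite /=; have [c c0 ->] := coords_class (hesse_zero_neq0 K).
by rewrite map_mxZ vline_scale ?fmorph_eq0 // map_hesse_zero.
Qed.

Lemma hesse_irreducible : geometrically_irreducible hesse_set.
Proof.
move=> F iota; split; first exact: inhabits (constant_point iota hesse_pt_zero).
have six : 6%:R != 0 :> F := char0_nat iota 5.
move=> Y Z YZ; apply: contrapT => /not_orP[].
move=> /existsNP[p pY] /existsNP[q qZ].
have [f fY fp] : exists2 f, f \in (Y : seq _) & mmap idfun (coords (val p) 0) f != 0.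
  by move/negP: pY => /allPn.
have [g gZ gq] : exists2 f, f \in (Z : seq _) & mmap idfun (coords (val q) 0) f != 0.
  by move/negP: qZ => /allPn.
have [df fd] := homogeneous_equations fY; have [dg gd] := homogeneous_equations gZ.
have lin h : chart_linear (fun w t : F => mmap idfun (chart w t 0) h).
  by apply: chart_linear_mmap => // i; apply: chart_linear_coord.
have [a [b fE]] := lin f; have [c [d gE]] := lin g.
have fg0 w t : chart_rel w t -> (a.[w] + b.[w] * t) * (c.[w] + d.[w] * t) = 0.
  move=> wt; rewrite -fE // -gE //.
  have u0 : chart w t != 0 by apply: chart_neq0.
  pose r : projpt F 2 := proj_class u0.
  have hr : on iota hesse_set r.
    by rewrite on_hesse_set (on_hesse_vline u0 (val_proj_class _)) (chart_on wt).
  have [e e0 rE] := coords_class u0.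
  have rmmap h k : h \is k.-homog -> mmap idfun (coords r 0) h = 0 ->
      mmap idfun (chart w t 0) h = 0.
    move=> hk; have -> : mmap idfun (coords r 0) h = mmap idfun (fun i => e * chart w t 0 i) h.
      by apply: mmap_eq => i; rewrite rE mxE.
    by rewrite (mmap_dhomog idfun _ _ hk) => /eqP;
      rewrite mulf_eq0 expf_eq0 (negPf e0) andbF => /eqP.
  case/orP: (YZ (exist _ r hr)) => /allP hall.
    by rewrite (rmmap _ _ fd) ?mul0r //; apply/eqP/hall.
  by rewrite (rmmap _ _ gd) ?mulr0 //; apply/eqP/hall.
have [] : (a = 0 /\ b = 0) \/ (c = 0 /\ d = 0).
- by apply: (@chart_linear_mul_eq0 _ six _ _ _ _ 0) => w t _; apply: fg0.
- move=> [a0 b0]; case/eqP: fp; apply: (hesse_chart_all six fd) (coords_neq0 _) _.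
    by move=> w t wt; rewrite fE // a0 b0 !horner0 mul0r addr0.
  exact/eqP/points_on_hesse.
move=> [a0 b0]; case/eqP: gq; apply: (hesse_chart_all six gd) (coords_neq0 _) _.
  by move=> w t wt; rewrite gE // a0 b0 !horner0 mul0r addr0.
exact/eqP/points_on_hesse.
Qed.

Lemma bihomogeneousXl m n (i : 'I_m) :
  bihomogeneous 1 0 ('X_(lshift n i) : {mpoly K[m + n]}).
Proof.
move=> a; rewrite msuppX inE => /eqP->; split.
  rewrite (bigD1 i) //= mnm1E eqxx big1 ?addn0 // => j ji.
  by rewrite mnm1E (inj_eq (@lshift_inj _ _)) eq_sym (negPf ji).
by rewrite big1 // => j _; rewrite mnm1E eq_lrshift.
Qed.

Lemma bihomogeneousXr m n (i : 'I_n) :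
  bihomogeneous 0 1 ('X_(rshift m i) : {mpoly K[m + n]}).
Proof.
move=> a; rewrite msuppX inE => /eqP->; split.
  by rewrite big1 // => j _; rewrite mnm1E eq_rlshift.
rewrite (bigD1 i) //= mnm1E eqxx big1 ?addn0 // => j ji.
by rewrite mnm1E (inj_eq (@rshift_inj _ _)) eq_sym (negPf ji).
Qed.

Lemma bihomogeneousM m n d e d' e' (f g : {mpoly K[m + n]}) :
  bihomogeneous d e f -> bihomogeneous d' e' g -> bihomogeneous (d + d') (e + e') (f * g).
Proof.
move=> hf hg a /msuppM_le /allpairsP[[b c] /= [/hf[bd be] /hg[cd ce] ->]].
by rewrite -bd -be -cd -ce -!big_split /=; split; apply: eq_bigr => i _; rewrite mnmDE.
Qed.

Lemma bihomogeneousB m n d e (f g : {mpoly K[m + n]}) :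
  bihomogeneous d e f -> bihomogeneous d e g -> bihomogeneous d e (f - g).
Proof. by move=> hf hg a /msuppB_le; rewrite mem_cat => /orP[/hf|/hg]. Qed.

Definition hesse_law_poly b : 'rV[{mpoly K[3 + 3]}]_3 :=
  hesse_law b (\row_i 'X_(lshift 3 i)) (\row_i 'X_(rshift 3 i)).

Lemma hesse_law_poly_bihomogeneous b j : bihomogeneous 2 2 (hesse_law_poly b 0 j).
Proof.
have XX i k : bihomogeneous 2 0 ('X_(lshift 3 i) * 'X_(lshift 3 k) : {mpoly K[3 + 3]}).
  by apply: (@bihomogeneousM _ _ 1 0 1 0); apply: bihomogeneousXl.
have YY i k : bihomogeneous 0 2 ('X_(rshift 3 i) * 'X_(rshift 3 k) : {mpoly K[3 + 3]}).
  by apply: (@bihomogeneousM _ _ 0 1 0 1); apply: bihomogeneousXr.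
have XXYY i k k' : bihomogeneous 2 2
    ('X_(lshift 3 i) ^+ 2 * 'X_(rshift 3 k) * 'X_(rshift 3 k') : {mpoly K[3 + 3]}).
  by rewrite -mulrA; apply: (@bihomogeneousM _ _ 2 0 0 2); [apply: XX | apply: YY].
have YYXX i k k' : bihomogeneous 2 2
    ('X_(rshift 3 i) ^+ 2 * 'X_(lshift 3 k) * 'X_(lshift 3 k') : {mpoly K[3 + 3]}).
  by rewrite -mulrA; apply: (@bihomogeneousM _ _ 0 2 2 0); [apply: YY | apply: XX].
case: b; case: j => [[|[|[|//]]] lt]; rewrite /hesse_law_poly /hesse_law !mxE /=;
  by apply: bihomogeneousB.
Qed.

Lemma eval_hesse_law_poly (F : fieldType) (iota : {rmorphism K -> F}) b u v :
  eval_row iota (hesse_law_poly b) (row_mx u v) = hesse_law b u v.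
Proof.
rewrite /eval_row map_hesse_law; congr hesse_law; apply/rowP => i.
  by rewrite 2!mxE /= mmapX mmap1U row_mxEl.
by rewrite 2!mxE /= mmapX mmap1U row_mxEr.
Qed.

Lemma hesse_add_morphism : morphism2 (fun F iota => @hesse_pt_add F iota).
Proof.
exists [:: hesse_law_poly false; hesse_law_poly true]; split.
  by move=> l; rewrite !inE => /orP[] /eqP->; exists 2, 2;
    apply: hesse_law_poly_bihomogeneous.
move=> F iota p q /=; have six : 6%:R != 0 :> F := char0_nat iota 5.
have hp := points_on_hesse p; have hq := points_on_hesse q; split.
  have [b b0 _] := hesse_addE six hp hq; exists (hesse_law_poly b).
    by case: (b); rewrite !inE eqxx ?orbT.
  by rewrite eval_hesse_law_poly.
move=> l lb; have [b ->] : exists b, l = hesse_law_poly b.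
  by move: lb; rewrite !inE => /orP[] /eqP->; [exists false|exists true].
by rewrite eval_hesse_law_poly; apply: val_hesse_add; rewrite ?coordsK.
Qed.

Lemma hesse_opp_morphism : morphism1 (fun F iota => @hesse_pt_opp F iota).
Proof.
have oE (F : fieldType) (iota : {rmorphism K -> F}) u :
    eval_row iota (hesse_opp (\row_i 'X_i)) u = hesse_opp u.
  by rewrite /eval_row map_hesse_opp mmap_row.
exists [:: hesse_opp (\row_i 'X_i)]; split.
  move=> l; rewrite inE => /eqP->; exists 1 => j.
  by case: j => [[|[|[|//]]] lt]; rewrite !mxE /= dhomogX /= mdeg1.
move=> F iota p /=; have p0 := coords_neq0 (val p); split.
  by exists (hesse_opp (\row_i 'X_i)); rewrite ?inE // oE hesse_opp_neq0.
move=> l; rewrite inE => /eqP->; rewrite oE => _.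
by apply: val_hesse_neg; rewrite ?coordsK.
Qed.

Definition hesse_variety : abelianVariety K.
Proof.
refine (@AbelianVariety K 2 hesse_set hesse_irreducible (fun F iota => @hesse_pt_add F iota)
  (fun F iota => @hesse_pt_opp F iota) hesse_pt_zero hesse_add_morphism hesse_opp_morphism
  _ _ _ _).
- move=> F iota p q r; apply/val_inj; apply: hesse_addA; rewrite ?points_on_hesse //.
  exact: (char0_nat iota 5).
- move=> F iota p q; apply/val_inj; apply: hesse_addC; rewrite ?points_on_hesse //.
  exact: (char0_nat iota 5).
- move=> F iota p; apply/val_inj; apply: hesse_add0; rewrite ?points_on_hesse //.
    exact: (char0_nat iota 5).
  exact: val_hesse_zero.
- move=> F iota p; apply/val_inj; apply: hesse_addN; rewrite ?points_on_hesse //.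
    exact: (char0_nat iota 5).
  exact: val_hesse_zero.
Defined.
End HesseVariety.
(** * Points close to the neutral element for a 2-adic valuation *)

Section ValuationRing.
Import classical_sets.
Variable L : fieldType.

Let dyadic (A : set L) :=
  [/\ forall x y, A x -> A y -> A (x - y), forall x y, A x -> A y -> A (x * y),
      forall x, A x -> A 1 & ~ A 2^-1].

Lemma exists_valuation_ring : (forall n, n.+1%:R != 0 :> L) ->
  exists R : subringClosed L, (forall x, (x \in R) || (x^-1 \in R)) /\ 2^-1 \notin R.
Proof.
move=> char0; have two : 2 != 0 :> L by apply: (char0 1).
have [A [[Asub Amul A1 A2] Amax]] : exists A, dyadic A /\ forall B, (A `<` B)%classic -> ~ dyadic B.
  apply: Zorn_bigcup => F FP Ftot; split.
  - move=> x y [B FB Bx] [C FC Cy].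
    have [BC|CB] := Ftot B C FB FC.
      by exists C => //; have [sub _ _ _] := FP C FC; apply: sub => //; apply: BC.
    by exists B => //; have [sub _ _ _] := FP B FB; apply: sub => //; apply: CB.
  - move=> x y [B FB Bx] [C FC Cy].
    have [BC|CB] := Ftot B C FB FC.
      by exists C => //; have [_ mul _ _] := FP C FC; apply: mul => //; apply: BC.
    by exists B => //; have [_ mul _ _] := FP B FB; apply: mul => //; apply: CB.
  - by move=> x [B FB Bx]; exists B => //; have [_ _ one _] := FP B FB; apply: one Bx.
  - by move=> [B FB Bx]; have [_ _ _] := FP B FB.
have eqA B : (A `<=` B)%classic -> dyadic B -> (B `<=` A)%classic.
  move=> AB dB x Bx; apply: contrapT => nAx.
  by apply: (Amax B) => //; split=> // BA; apply/nAx/BA.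
have oneA : A 1.
  apply: contrapT => nA1; have A0 x : ~ A x by move=> /A1.
  pose Z : set L := [set x | exists n : int, x = n%:~R]%classic.
  suff dZ : dyadic Z by apply: (A0 1); apply: (eqA Z _ dZ); [move=> x /A0 | exists 1].
  split.
  - by move=> _ _ [n ->] [k ->]; exists (n - k); rewrite rmorphB.
  - by move=> _ _ [n ->] [k ->]; exists (n * k); rewrite rmorphM.
  - by move=> _ _; exists 1.
  move=> [n nE]; have : (2 * n)%:~R = 1 :> L by rewrite intrM -nE mulfV.
  have int0 k : k%:~R = 0 :> L -> k = 0.
    case: k => [[//|k]|k] /=; first by move/eqP; rewrite (negPf (char0 k)).
    by rewrite NegzE rmorphN /= => /eqP; rewrite oppr_eq0 (negPf (char0 k)).
  move/eqP; rewrite -subr_eq0 -(rmorphB _ (2 * n) 1) => /eqP/int0/eqP.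
  by rewrite subr_eq0 => /eqP/(congr1 (fun k : int => odd `|k|)); rewrite abszM oddM.
have subringA : subring_closed (fun x => `[< A x >]).
  split; first exact/asboolP.
  - by move=> x y /asboolP Ax /asboolP Ay; apply/asboolP/Asub.
  - by move=> x y /asboolP Ax /asboolP Ay; apply/asboolP/Amul.
pose R : subringClosed L := HB.pack (fun x => `[< A x >] : bool)
  (GRing.isSubringClosed.Build L (fun x => `[< A x >]) subringA).
have RP x : x \in R <-> A x by split=> [/asboolP|/asboolP].
exists R; have R2 : 2^-1 \notin R by apply/negP => /RP.
split=> // x; have unitR a : a \in R -> 1 - 2 * a != 0 /\ (1 - 2 * a)^-1 \in R.
  move=> Ra; have u0 : 1 - 2 * a != 0.
    rewrite subr_eq0; apply: contraNneq R2 => e.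
    by rewrite (_ : 2^-1 = a) //; apply: (mulfI two); rewrite mulfV.
  split=> //; have pow k : exists2 c, c \in R & (1 - 2 * a) ^+ k = 1 - 2 * c.
    elim: k => [|k [c Rc e]]; first by exists 0; rewrite ?rpred0 // mulr0 subr0.
    exists (a + c - 2 * a * c); first by rewrite rpredB ?rpredD ?rpredM ?rpred_nat.
    by rewrite exprS e; ring.
  pose B : set L := [set y | exists k, y * (1 - 2 * a) ^+ k \in R]%classic.
  apply/RP/(eqA B).
  - by move=> y /RP Ry; exists 0; rewrite mulr1.
  - have Ru k : (1 - 2 * a) ^+ k \in R by rewrite rpredX ?rpredB ?rpred1 ?rpredM ?rpred_nat.
    split.
    + move=> y z [k Ry] [l Rz]; exists (k + l).
      by rewrite mulrBl exprD rpredB //; [rewrite mulrA rpredM | rewrite mulrCA rpredM].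
    + by move=> y z [k Ry] [l Rz]; exists (k + l); rewrite exprD mulrACA rpredM.
    + by move=> _ _; exists 0; rewrite mulr1 rpred1.
    move=> [k]; have [c Rc ->] := pow k => Rk; case/negP: R2.
    rewrite (_ : 2^-1 = 2^-1 * (1 - 2 * c) + c) ?rpredD //.
    by rewrite mulrBr mulr1 mulKf // subrK.
  by exists 1; rewrite expr1 mulVf ?rpred1.
have [x0|x0] := eqVneq x 0; first by rewrite x0 rpred0.
apply: contrapT => /negP; rewrite negb_or => /andP[Rx Ry].
have adjoin z : z \notin R -> exists p : {poly L}, p \is a polyOver R /\ p.[z] = 2^-1.
  move=> Rz; apply: contrapT => noP; case/negP: Rz.
  pose B : set L := [set y | exists2 p : {poly L}, p \is a polyOver R & y = p.[z]]%classic.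
  apply/RP/(eqA B); last by exists 'X; rewrite ?polyOverX ?hornerX.
    by move=> y /RP Ry'; exists y%:P; rewrite ?polyOverC ?hornerC.
  split.
  - by move=> _ _ [p pR ->] [q qR ->]; exists (p - q); rewrite ?rpredB // !hornerE.
  - by move=> _ _ [p pR ->] [q qR ->]; exists (p * q); rewrite ?rpredM // !hornerE.
  - by move=> _ _; exists 1; rewrite ?rpred1 ?hornerC.
  by move=> [p pR e]; apply: noP; exists p.
have descent z (p q : {poly L}) : z != 0 -> p \is a polyOver R -> q \is a polyOver R ->
    p.[z] = 2^-1 -> q.[z^-1] = 2^-1 -> (size q <= size p)%N ->
    exists p' : {poly L}, [/\ p' \is a polyOver R, p'.[z] = 2^-1 & (size p' < size p)%N].
  move=> z0 pR qR pz qz qp.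
  have [q0 q0'] : 1 - 2 * q`_0 != 0 /\ (1 - 2 * q`_0)^-1 \in R by apply/unitR/polyOverP.
  have qn0 : size q != 0%N.
    rewrite size_poly_eq0; apply: contraNneq two => q00.
    by move/eqP: qz; rewrite q00 horner0 eq_sym invr_eq0.
  have [m qm] : exists m, size q = m.+1 by case: (size q) qn0 => // m; exists m.
  have [n pn] : exists n, size p = n.+1 by case: (size p) qp => [|n]; rewrite ?qm //; exists n.
  have mn : (m <= n)%N by move: qp; rewrite pn qm.
  pose s : {poly L} := \poly_(j < m) ((1 - 2 * q`_0)^-1 * 2 * q`_(m - j)).
  have sz : s.[z] = z ^+ m.
    have := horner_coef q z^-1; rewrite qz qm big_ord_recl /= expr0 mulr1 => qE.
    apply: (mulfI q0); rewrite horner_poly mulr_sumr; symmetry.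
    transitivity (\sum_(i < m) 2 * q`_i.+1 * z ^+ (m - i.+1)).
      transitivity (2 * (2^-1 - q`_0) * z ^+ m); first by rewrite mulrBr mulfV.
      rewrite qE addrAC subrr add0r mulr_sumr mulr_suml; apply: eq_bigr => i _.
      rewrite /bump /= add1n exprVn -!mulrA; congr (_ * (_ * _)).
      by rewrite -{2}(subnKC (ltn_ord i)) exprD mulKf ?expf_neq0.
    rewrite [RHS](reindex_inj rev_ord_inj) /=; apply: eq_bigr => i _.
    by rewrite -!mulrA mulVKf ?subKn //.
  exists (\poly_(i < n) p`_i + p`_n *: ('X^(n - m) * s)); split.
  - rewrite rpredD ?polyOverZ ?rpredM ?polyOverXn //; last 1 first.
    + by apply/polyOver_poly => j _; rewrite !rpredM ?rpred_nat //; apply/polyOverP.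
    + by apply/polyOver_poly => j _; apply/polyOverP.
    by apply/polyOverP.
  - rewrite -pz hornerD hornerZ hornerM hornerXn sz -exprD subnK //.
    by rewrite (horner_coef p) pn big_ord_recr /= horner_poly.
  rewrite pn ltnS (leq_trans (size_polyD _ _)) // geq_max size_poly /=.
  rewrite (leq_trans (size_scale_leq _ _)) // (leq_trans (size_polyMleq _ _)) //.
  rewrite size_polyXn /= (leq_trans (leq_add (leqnn _) (size_poly _ _))) //.
  by rewrite subnK.
have [p [pR px]] := adjoin x Rx; have [q [qR qx]] := adjoin _ Ry.
have [k] := ubnP (size p + size q)%N; elim: k => // k IHk in p q pR px qR qx *.
rewrite ltnS => pqk; have [qp|/ltnW pq] := leqP (size q) (size p).
  have [p' [p'R p'x sp]] := descent x p q x0 pR qR px qx qp.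
  by apply: (IHk p' q) => //; rewrite (leq_trans _ pqk) // ltn_add2r.
have y0 : x^-1 != 0 by rewrite invr_eq0.
have [|q' [q'R q'x sq]] := descent x^-1 q p y0 qR pR qx _ pq; first by rewrite invrK.
by apply: (IHk p q') => //; rewrite (leq_trans _ pqk) // ltn_add2l.
Qed.
End ValuationRing.

Section ValuationIdeal.
Variables (L : fieldType) (R : subringClosed L).
Hypothesis R_total : forall x, (x \in R) || (x^-1 \in R).
Implicit Types x y : L.

Definition nonunit x := (x == 0) || (x^-1 \notin R).

Lemma unit_inv x : ~~ nonunit x -> x != 0 /\ x^-1 \in R.
Proof. by rewrite negb_or negbK => /andP[]. Qed.

Lemma nonunit_in x : nonunit x -> x \in R.
Proof.
by case/orP => [/eqP->|/negPf Rx]; [rewrite rpred0 | have := R_total x; rewrite Rx orbF].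
Qed.

Lemma nonunit1 : ~~ nonunit 1.
Proof. by rewrite /nonunit oner_eq0 invr1 rpred1. Qed.

Lemma nonunitM x y : nonunit x -> y \in R -> nonunit (x * y).
Proof.
rewrite /nonunit mulf_eq0; have [//|x0] := eqVneq x 0; have [//|y0] := eqVneq y 0.
move=> /= Rx Ry; apply: contra Rx => Rxy.
have -> : x^-1 = y * (x * y)^-1 by field; rewrite x0 y0.
exact: rpredM.
Qed.

Lemma nonunitD x y : nonunit x -> nonunit y -> nonunit (x + y).
Proof.
have [->|x0] := eqVneq x 0; first by rewrite add0r.
have [->|y0] := eqVneq y 0; first by rewrite addr0.
move=> mx my; have := R_total (y / x); rewrite invf_div => /orP[] Ryx.
  rewrite (_ : x + y = x * (1 + y / x)); last by field.
  by apply: nonunitM => //; rewrite rpredD ?rpred1.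
rewrite (_ : x + y = y * (1 + x / y)); last by field.
by apply: nonunitM => //; rewrite rpredD ?rpred1.
Qed.

Lemma nonunitN x : nonunit (- x) = nonunit x.
Proof. by rewrite /nonunit oppr_eq0 invrN rpredN. Qed.

Lemma unitM x y : ~~ nonunit x -> ~~ nonunit y -> ~~ nonunit (x * y).
Proof.
rewrite /nonunit !negb_or !negbK mulf_eq0 negb_or invfM.
by move=> /andP[-> Rx] /andP[-> Ry]; rewrite rpredM.
Qed.

Lemma unitV x : ~~ nonunit x -> x \in R -> ~~ nonunit x^-1.
Proof. by move=> /unit_inv[x0 _] Rx; rewrite negb_or invr_eq0 x0 invrK negbK. Qed.

Lemma unitX x n : ~~ nonunit x -> ~~ nonunit (x ^+ n).
Proof. by move=> ux; elim: n => [|n]; rewrite ?expr0 ?nonunit1 // exprS; apply: unitM. Qed.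

Lemma nonunit_unitD x y : nonunit x -> ~~ nonunit y -> ~~ nonunit (x + y).
Proof.
move=> mx; apply: contra => mxy.
by rewrite -(addrK x y) addrC nonunitD ?nonunitN // addrC.
Qed.

End ValuationIdeal.

Ltac solve_rpred := repeat first [assumption | exact: rpred_nat | exact: rpred1 |
  match goal with
  | |- is_true (_ ^+ _ \in _) => apply: rpredX
  | |- is_true (_ * _ \in _) => apply: rpredM
  | |- is_true (- _ \in _) => rewrite rpredN
  | |- is_true (_ + _ \in _) => apply: rpredD
  end].

(* A neighbourhood of the neutral element for a valuation above 2. It is a
   torsion-free subgroup because doubling multiplies the parameter z by 2 up to
   a unit. The bound on z is sharp: some points with parameter of valuation 0
   have order 2. *)
Section TorsionFree.
Variables (L : fieldType) (R : subringClosed L).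
Hypothesis R_total : forall x, (x \in R) || (x^-1 \in R).
Hypothesis R2 : nonunit R 2.
Hypothesis six : 6%:R != 0 :> L.

Definition near_zero (z : L) (p : projpt L 2) :=
  nonunit R z /\ exists2 e, e \in R & val p = <[row3 1 (-1 + 2 * e) (2 * z)]>%VS.

Let unit2D (r x : L) : r \in R -> ~~ nonunit R x -> ~~ nonunit R (x + 2 * r).
Proof. by move=> Rr; rewrite addrC; apply: nonunit_unitD => //; apply: nonunitM. Qed.

Let unitN1 : ~~ nonunit R (-1).
Proof. by rewrite nonunitN nonunit1. Qed.

Lemma near_zero_vline (p : projpt L 2) x y z : ~~ nonunit R x -> nonunit R z ->
  y \in R -> val p = <[row3 x (- x + 2 * y) (2 * z)]>%VS -> near_zero (z / x) p.
Proof.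
rewrite negb_or negbK => /andP[x0 Rx] mz Ry pE; split; first exact: nonunitM.
exists (y / x); rewrite ?rpredM // pE -[in RHS](vline_scale _ x0) scale_row3.
by congr (<[row3 _ _ _]>%VS); field.
Qed.

Lemma near_zero_opp p z : near_zero z p -> exists z', near_zero z' (hesse_neg p).
Proof.
move=> [mz [e Re pE]]; exists (z / (-1 + 2 * e)).
have u0 : row3 1 (-1 + 2 * e) (2 * z) != 0 by rewrite row3_neq0 !mxE oner_neq0.
apply: (near_zero_vline _ mz Re).
  exact: unit2D.
by rewrite (val_hesse_neg u0 pE) /hesse_opp !mxE /=; congr (<[row3 _ _ _]>%VS); ring.
Qed.

Lemma near_zero_add p q z t : on_hesse p -> on_hesse q ->
  near_zero z p -> near_zero t q -> exists z', near_zero z' (hesse_add p q).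
Proof.
move=> hp hq [mz [e Re pE]] [mt [f Rf qE]].
have Rz := nonunit_in R_total mz; have Rt := nonunit_in R_total mt.
set u := row3 _ _ _ in pE; set v := row3 _ _ _ in qE.
pose w := hesse_law true u v.
have R2' : 2 \in R := nonunit_in R_total R2.
have Rn n : n%:R \in R := rpred_nat R n.
pose x := -1 + 2 * (f - 4 * t ^+ 2 * (-1 + 2 * e) * z).
pose y := 4 * z ^+ 2 * t - f + 2 * f ^+ 2 - e + 4 * e * f - 4 * e * f ^+ 2
  - 4 * t ^+ 2 * (-1 + 2 * e) * z.
pose s := (-1 + 2 * e) ^+ 2 * (-1 + 2 * f) * t - z.
have Re' : -1 + 2 * e \in R by solve_rpred.
have Rf' : -1 + 2 * f \in R by solve_rpred.
have ux : ~~ nonunit R x by apply: unit2D => //; solve_rpred.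
have wE : hesse_law true u v = row3 x (- x + 2 * y) (2 * s).
  by rewrite /hesse_law !mxE /=; congr row3; rewrite /x /y /s; ring.
have w0 : hesse_law true u v != 0.
  by rewrite wE row3_neq0 !mxE /=; case/unit_inv: ux => ->.
exists (s / x); apply: (near_zero_vline (y := y) ux).
- by apply: nonunitD; rewrite // ?nonunitN // mulrC; apply: nonunitM => //; solve_rpred.
- by rewrite ?/y; solve_rpred.
by rewrite (val_hesse_add six hp hq pE qE w0) wE.
Qed.

Lemma near_zero_double p z : on_hesse p -> near_zero z p ->
  exists c, [/\ c \in R, ~~ nonunit R c & near_zero (2 * z * c) (hesse_add p p)].
Proof.
move=> hp [mz [e Re pE]].
have Rz := nonunit_in R_total mz.
set u := row3 _ _ _ in pE; pose y := -1 + 2 * e.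
have R2' : 2 \in R := nonunit_in R_total R2.
have Rn n : n%:R \in R := rpred_nat R n.
have u0 : u != 0 by rewrite row3_neq0 !mxE oner_neq0.
have hu : hesse u = 0 by apply/eqP; rewrite -(on_hesse_vline u0 pE).
pose d := 1 - 8 * z ^+ 3.
have ud : ~~ nonunit R d.
  rewrite /d (_ : 8 * z ^+ 3 = 2 * (4 * z ^+ 3)); last by ring.
  by rewrite -mulrN; apply: unit2D; rewrite ?nonunit1 //; solve_rpred.
have uy : ~~ nonunit R y by apply: unit2D.
have [d0 Rd'] := unit_inv ud; have [y0 Ry'] := unit_inv uy.
have Ry : y \in R by rewrite /y; solve_rpred.
have wE : hesse_law true u u = row3 (y * d) (8 * z ^+ 3 - y ^+ 3) (2 * z * (y ^+ 3 - 1)).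
  by rewrite /hesse_law !mxE /=; congr row3; rewrite /y /d; ring.
have y3 : y ^+ 3 = - 1 - 8 * z ^+ 3 - 6 * y * z.
  by apply/eqP; rewrite -subr_eq0 -hu /hesse !mxE /=; apply/eqP; rewrite /y; ring.
pose c := - (1 + (3 * y + 4 * z ^+ 2) * z) / (y * d).
have uc : ~~ nonunit R c.
  apply: unitM; last by apply: unitV; rewrite ?unitM ///d; solve_rpred.
  rewrite nonunitN addrC; apply: nonunit_unitD; rewrite ?nonunit1 // mulrC.
  by apply: nonunitM => //; solve_rpred.
exists c; split=> //.
  by rewrite /c invfM; solve_rpred.
have -> : 2 * z * c = (2 * z * - (1 + (3 * y + 4 * z ^+ 2) * z)) / (y * d) by rewrite /c mulrA.
have w0 : hesse_law true u u != 0.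
  by rewrite wE row3_neq0 !mxE /= mulf_eq0 (negPf y0) (negPf d0).
apply: (@near_zero_vline _ (y * d) (e + 8 * z ^+ 3 + 3 * y * z - 4 * y * z ^+ 3)).
- exact: unitM.
- by rewrite -mulrA; apply: nonunitM => //; solve_rpred.
- by rewrite ?/y; solve_rpred.
rewrite (val_hesse_add six hp hp pE pE w0) wE; congr (<[row3 _ _ _]>%VS).
  by rewrite y3 /d /y; ring.
by rewrite y3; ring.
Qed.

Lemma near_zero_uniq p z z' : near_zero z p -> near_zero z' p -> z = z'.
Proof.
have two0 : 2 != 0 :> L.
  by apply: contraNneq six => e; rewrite (natrM _ 2 3) e mul0r.
move=> [_ [e _ pE]] [_ [e' _]]; rewrite pE => /vline_eqP[|c _ /rowP E].
  by rewrite row3_neq0 !mxE oner_neq0.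
have := E 0; have := E 2; rewrite !mxE /= mulr1 => zE c1.
by move: zE; rewrite -c1 mul1r => /(mulfI two0).
Qed.

Lemma near_zero0 p : on_hesse p -> near_zero 0 p -> val p = <[hesse_zero L]>%VS.
Proof.
move=> hp [_ [e Re pE]]; rewrite pE; set u := row3 _ _ _ in pE *.
have u0 : u != 0 by rewrite row3_neq0 !mxE oner_neq0.
have hu : hesse u = 0 by apply/eqP; rewrite -(on_hesse_vline u0 pE).
have [] : 2 * e = 0 \/ 1 + 2 * (1 - 3 * e + 2 * e ^+ 2) = 0 :> L.
- have : (2 * e) * (1 + 2 * (1 - 3 * e + 2 * e ^+ 2)) == 0.
    by apply/eqP; rewrite -hu /hesse !mxE /=; ring.
  by rewrite mulf_eq0 => /orP[] /eqP; [left | right].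
- by rewrite /u => ->; rewrite addr0 mulr0.
have : ~~ nonunit R (1 + 2 * (1 - 3 * e + 2 * e ^+ 2)).
  by apply: unit2D; rewrite ?nonunit1 //; solve_rpred.
by move=> /unit_inv[/eqP].
Qed.

Section Torsion.
Variables (K : fieldExtType rat) (iota : {rmorphism K -> L}).
Local Notation E := (rational_points (hesse_variety K) iota).

Lemma near_zero_torsion (p : E) z n :
  near_zero z (val p) -> (0 < n)%N -> p *+ n = 0 -> p = 0.
Proof.
move=> pz n0 np; have hE (q : E) : on_hesse (val q) by apply: points_on_hesse.
have two_pow k : exists c,
    [/\ c \in R, ~~ nonunit R c & near_zero (2 ^+ k * z * c) (val (p *+ (2 ^ k)))].
  elim: k => [|k [c [Rc uc pk]]].
    by exists 1; rewrite rpred1 nonunit1 mulr1 mul1r mulr1n.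
  have [d [Rd ud pd]] := near_zero_double (hE _) pk.
  exists (c * d); split; [exact: rpredM | exact: unitM |].
  by rewrite expnS mul2n -addnn mulrnDr exprS; move: pd; rewrite !mulrA.
pose a := logn 2 n; pose b := (totient n`_2^')%N.
have e : p *+ (2 ^ a) = p *+ (2 ^ (a + b)).
  have /dvdnP[k kE] : (n %| 2 ^ (a + b) - 2 ^ a)%N.
    rewrite expnD -[X in (_ - X)%N]muln1 -mulnBr -{1}(partnC 2%N n0) p_part
      dvdn_pmul2l ?expn_gt0 //.
    rewrite -eqn_mod_dvd ?expn_gt0 //; apply/eqP/Euler_exp_totient.
    by rewrite (@pnat_coprime 2%N) ?part_pnat ?pnat_id.
  rewrite -[in RHS](subnK (leq_pexp2l (isT : 0 < 2)%N (leq_addr b a))) kE.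
  by rewrite mulrnDr mulnC mulrnA np mul0rn add0r.
have [c [Rc uc pa]] := two_pow a; have [d [Rd ud pb]] := two_pow (a + b)%N.
move: pb; rewrite -e => /(near_zero_uniq pa); rewrite exprD -!mulrA.
have two0 : 2 != 0 :> L.
  by apply: contraNneq six => e'; rewrite (natrM _ 2 3) e' mul0r.
move/(mulfI (expf_neq0 _ two0)); rewrite mulrCA => cd.
have [z0|z0] := eqVneq z 0.
  move: pz; rewrite z0 => /(near_zero0 (hE p)) pE.
  by apply/val_inj/val_inj; rewrite pE -(val_hesse_zero iota).
move/(mulfI z0): cd => cd; case/negP: uc; rewrite cd.
have: (0 < b)%N by rewrite totient_gt0 part_gt0.
case: b {e} cd => // b cd _; rewrite exprS -mulrA nonunitM //; apply: rpredM => //.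
by rewrite rpredX ?rpred_nat.
Qed.
End Torsion.
End TorsionFree.
(** * Galois groups as permutation groups *)

Lemma transitive_tperm_sym p (H : {group 'S_p}) (i0 j0 : 'I_p) : prime p ->
  (forall i j, exists2 h : 'S_p, h \in H & h i = j) ->
  i0 != j0 -> tperm i0 j0 \in H -> H = [set: 'S_p] :> {set 'S_p}.
Proof.
move=> pp Htrans ij0 Hij; pose r := [rel i j | tperm i j \in H].
have r_equiv : {in [set: 'I_p] & &, equivalence_rel r}.
  move=> i j k _ _ _ /=; split; first by rewrite tperm1 group1.
  move=> rij; have [-> //|ki] := eqVneq k i.
    by rewrite tperm1 group1 tpermC rij.
  have [->|kj] := eqVneq k j; first by rewrite tperm1 group1 rij.
  have [ij|ij] := eqVneq i j; first by rewrite ij.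
  rewrite -(groupJr _ rij) (_ : tperm i k ^ tperm i j = tperm j k)%g //.
  by rewrite tpermJ tpermL tpermD // eq_sym.
pose c := #|[set j | r i0 j]|; pose P : {set {set 'I_p}} := equivalence_partition r [set: 'I_p].
have parP : partition P [set: 'I_p] by apply: equivalence_partitionP.
have Pc : {in P, forall A : {set 'I_p}, #|A| = c}.
  move=> A /imsetP[i _ ->]; have [h Hh hi] := Htrans i0 i.
  rewrite /c -[RHS](card_imset _ (@perm_inj _ h)); apply: eq_card => j.
  rewrite !inE; apply/idP/imsetP => [rij|[k]].
    exists (h^-1%g j); rewrite ?permKV // inE /= -(groupJr _ Hh).
    by rewrite tpermJ hi permKV.
  by rewrite inE /= => rk ->; rewrite -hi -tpermJ groupJ.
have : (c %| p)%N.
  by have := card_uniform_partition Pc parP; rewrite cardsT card_ord => ->; apply: dvdn_mull.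
have c2 : (1 < c)%N.
  by apply/card_gt1P; exists i0, j0; rewrite !inE /= tperm1 group1 Hij ij0.
move/primeP: pp => [_ /[apply]]; rewrite gtn_eqF //= => /eqP cp.
have all_r i j : tperm i j \in H.
  have all0 k : tperm i0 k \in H.
    have : [set j | r i0 j] = [set: 'I_p].
      by apply/eqP; rewrite eqEcard subsetT cardsT card_ord -/c cp leqnn.
    by move/setP/(_ k); rewrite !inE.
  have [h Hh <-] := Htrans i0 i.
  by rewrite -(permKV h j) -tpermJ groupJ.
apply/setP => s; rewrite inE; have [ts -> _] := prod_tpermP s.
by apply: group_prod => t _.
Qed.

Section GaloisPerm.
Variables (F : fieldType) (L : splittingFieldType F).

Lemma mem_gal1 (s : gal_of {:L}) : s \in 'Gal({:L} / 1%AS)%g.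
Proof. by rewrite gal_kAut ?sub1v // kAut1E limg_gal. Qed.

Lemma gal_of_lrmorphism (f : {lrmorphism L -> L}) : exists s : gal_of {:L}, s =1 f.
Proof.
have homf : kHom 1 {:L} (linfun f) by rewrite k1HomE linfun_is_ahom.
have [|s _ sf] := kHom_to_gal _ (normalFieldf 1) homf.
  by rewrite sub1v subvv.
by exists s => x; rewrite -sf ?memvf // lfunE.
Qed.

Variables (p : nat) (r : 'I_p -> L).
Hypothesis r_inj : injective r.

Definition gal_perm (s : gal_of {:L}) (sigma : 'S_p) := forall i, s (r i) = r (sigma i).

Lemma gal_perm1 : gal_perm 1%g 1%g.
Proof. by move=> i; rewrite gal_id perm1. Qed.

Lemma gal_permM s t sigma tau : gal_perm s sigma -> gal_perm t tau ->
  gal_perm (s * t)%g (sigma * tau)%g.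
Proof. by move=> hs ht i; rewrite galM ?memvf // hs ht permM. Qed.

Variable f : {poly F}.
Hypothesis f_irr : irreducible_poly f.
Hypothesis f_roots : map_poly (in_alg L) f %= \prod_i ('X - (r i)%:P).

Lemma root_map_poly x : root (map_poly (in_alg L) f) x = (x \in codom r).
Proof.
rewrite (eqp_root f_roots); have -> : \prod_i ('X - (r i)%:P) = \prod_(y <- codom r) ('X - y%:P).
  by rewrite big_image.
by rewrite root_prod_XsubC.
Qed.

Lemma gal_perm_exists s : exists sigma, gal_perm s sigma.
Proof.
have sr i : s (r i) \in codom r.
  rewrite -root_map_poly; have : root (map_poly (in_alg L) f) (r i).
    by rewrite root_map_poly codom_f.
  rewrite -(fmorph_root (s : {rmorphism L -> L})) -map_poly_comp.
  by congr root; apply: eq_map_poly => a /=; rewrite linearZ /= rmorph1.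
have sri i : {j | s (r i) = r j} by apply/sig_eqW/codomP.
pose g i := sval (sri i); have gE i : s (r i) = r (g i) by rewrite /g; case: (sri i).
have g_inj : injective g.
  by move=> i j gij; apply/r_inj/(fmorph_inj (s : {rmorphism L -> L})); rewrite /= !gE gij.
by exists (perm g_inj) => i; rewrite permE gE.
Qed.

Lemma gal_transitive i j : exists s : gal_of {:L}, s (r i) = r j.
Proof.
have fi : root (map_poly (in_alg L) f) (r i) by rewrite root_map_poly codom_f.
have /polyOver1P[g gE] := minPolyOver 1 (r i).
have mf : minPoly 1 (r i) %= map_poly (in_alg L) f.
  rewrite gE eqp_map; have [_ f_min] := f_irr; apply: f_min.
    by rewrite -(size_map_poly (in_alg L)) -gE size_minPoly eqSS -lt0n.
  rewrite -(dvdp_map (in_alg L)) -gE minPoly_dvdp //.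
  by apply/polyOver1P; exists f.
have : root (minPoly 1 (r i)) (r j).
  by rewrite (eqp_root mf) root_map_poly codom_f.
by case/(normalField_root_minPoly (sub1v _) (normalFieldf 1) (memvf _)) => s _; exists s.
Qed.

Hypothesis p_prime : prime p.

Lemma gal_perm_surj (t : gal_of {:L}) i0 j0 : i0 != j0 -> gal_perm t (tperm i0 j0) ->
  forall sigma, exists s, gal_perm s sigma.
Proof.
move=> ij0 ht; pose H := [set sigma : 'S_p | `[< exists s, gal_perm s sigma >]].
have H_group : group_set H.
  apply/group_setP; split=> [|sigma tau].
    by rewrite inE; apply/asboolP; exists 1%g; apply: gal_perm1.
  rewrite !inE => /asboolP[s hs] /asboolP[s' hs']; apply/asboolP.
  by exists (s * s')%g; apply: gal_permM.
have HT : Group H_group = [set: 'S_p] :> {set 'S_p}.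
  apply: transitive_tperm_sym p_prime _ ij0 _ => [i j|]; last first.
    by rewrite inE; apply/asboolP; exists t.
  have [s sij] := gal_transitive i j; have [sigma hs] := gal_perm_exists s.
  exists sigma; first by rewrite inE; apply/asboolP; exists s.
  by apply: r_inj; rewrite -hs.
by move=> sigma; have := in_setT sigma; rewrite -HT inE => /asboolP.
Qed.
End GaloisPerm.
(** * A polynomial with symmetric Galois group *)

(* Newton's e_1 ^ 2 - 2 e_2, for g monic of degree n; the two extra zero roots
   due to 'X^2 make it meaningful for n < 2. *)
Section RootSquares.
Variable R : comNzRingType.
Implicit Types g h : {poly R}.

Definition root_squares n g :=
  ('X^2 * g)`_n.+1 ^+ 2 - 2 * ('X^2 * g)`_n.

Lemma root_squares_XsubC n g a : g`_n = 1 ->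
  root_squares n.+1 (('X - a%:P) * g) = a ^+ 2 + root_squares n g.
Proof.
move=> gn; have gn2 : ('X^2 * g)`_n.+2 = 1 by rewrite coefXnM subn2.
rewrite /root_squares mulrCA !mulrBl !coefB !coefXM !coefCM gn2 /=; ring.
Qed.

Lemma monic_coef_size g n : g \is monic -> size g = n.+1 -> g`_n = 1.
Proof. by rewrite monicE lead_coefE => /eqP + sg; rewrite sg. Qed.

Lemma root_squares_prod (s : seq R) g n : g \is monic -> size g = n.+1 ->
  root_squares (size s + n) ((\prod_(a <- s) ('X - a%:P)) * g) =
  \sum_(a <- s) a ^+ 2 + root_squares n g.
Proof.
move=> gm sg; elim: s => [|a s IHs]; first by rewrite !big_nil mul1r add0r.
rewrite !big_cons -addrA -IHs -mulrA root_squares_XsubC //.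
apply: monic_coef_size; first by rewrite rpredM ?monic_prod_XsubC.
by rewrite size_Mmonic ?monic_neq0 ?monic_prod_XsubC // size_prod_XsubC sg addSn addnS.
Qed.

Lemma root_squares_prod1 (s : seq R) :
  root_squares (size s) (\prod_(a <- s) ('X - a%:P)) = \sum_(a <- s) a ^+ 2.
Proof.
have := @root_squares_prod s 1 0 (monic1 _) (size_poly1 _).
by rewrite addn0 mulr1 => ->; rewrite /root_squares mulr1 !coefXn /= expr0n mulr0 subr0 addr0.
Qed.
End RootSquares.

(* The abscissae w of the points of the cubic with t = 1 / (2 \prod_j (D w - 3 j))
   are the u / D for the roots u of this polynomial *)
Section RootPolynomial.
Variables m D : nat.

Section Generic.
Variable R : comNzRingType.

Definition root_nodes : seq R := [seq (3 * j.+1)%:R | j <- iota 0 m].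

Definition node_poly : {poly R} := \prod_(a <- root_nodes) ('X - a%:P).

Definition scaled_chart_poly : {poly R} :=
  cubic_poly (3 * D)%:R (24 * D ^ 2)%:R (48 * D ^ 3)%:R.

Definition root_poly_core : {poly R} := node_poly ^+ 2 * scaled_chart_poly.

Definition root_poly : {poly R} := 4%:R *: root_poly_core - (3 * D ^ 3)%:R%:P.

Lemma node_poly_monic : node_poly \is monic.
Proof. exact: monic_prod_XsubC. Qed.

Lemma size_node_poly : size node_poly = m.+1.
Proof. by rewrite size_prod_XsubC size_map size_iota. Qed.

Lemma root_poly_core_monic : root_poly_core \is monic.
Proof. by rewrite rpredM ?rpredX ?node_poly_monic ?cubic_poly_monic. Qed.

Lemma size_root_poly_core : size root_poly_core = (2 * m + 4)%N.
Proof.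
have sq : size (node_poly ^+ 2) = (2 * m).+1.
  by rewrite expr2 size_Mmonic ?monic_neq0 ?node_poly_monic // size_node_poly
      addSn addnS mul2n addnn.
rewrite size_Mmonic ?cubic_poly_monic ?monic_neq0 ?rpredX ?node_poly_monic //.
by rewrite sq size_cubic_poly.
Qed.

Lemma root_squares_core : root_squares (2 * m + 3) root_poly_core =
  2 * \sum_(a <- root_nodes) a ^+ 2 + (9 * D ^ 2)%:R - (48 * D ^ 2)%:R.
Proof.
have sn : size root_nodes = m by rewrite size_map size_iota.
have -> : (2 * m + 3 = size root_nodes + (size root_nodes + 3))%N.
  by rewrite sn mul2n -addnn addnA.
rewrite /root_poly_core expr2 -mulrA.
have gm : node_poly * scaled_chart_poly \is monic.
  by rewrite rpredM ?node_poly_monic ?cubic_poly_monic.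
rewrite root_squares_prod //; last first.
  rewrite size_Mmonic ?monic_neq0 ?node_poly_monic ?cubic_poly_monic //.
  by rewrite size_cubic_poly size_node_poly sn !addnS.
rewrite root_squares_prod ?cubic_poly_monic ?size_cubic_poly //.
rewrite /root_squares /scaled_chart_poly /cubic_poly !coefXnM /=.
rewrite !(coefD, coefMX, coefCM, coefXn, coefX, coefC) /=.
by ring.
Qed.
End Generic.

Lemma map_root_poly (R S : comNzRingType) (f : {rmorphism R -> S}) :
  map_poly f (root_poly R) = root_poly S.
Proof.
rewrite /root_poly rmorphB /= map_polyZ map_polyC /= !rmorph_nat; congr (_ *: _ - _).
rewrite /root_poly_core rmorphM rmorphXn /= map_cubic_poly !rmorph_nat.
congr (_ ^+ 2 * _); rewrite /node_poly rmorph_prod /= !big_map.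
by apply: eq_bigr => i _; rewrite rmorphB /= map_polyX map_polyC /= rmorph_nat.
Qed.

Lemma horner_root_poly (R : comNzRingType) (x : R) : (root_poly R).[x] =
  4 * (\prod_(a <- root_nodes R) (x - a)) ^+ 2 *
    (x ^+ 3 + (3 * D)%:R * x ^+ 2 + (24 * D ^ 2)%:R * x + (48 * D ^ 3)%:R) - (3 * D ^ 3)%:R.
Proof.
rewrite /root_poly /root_poly_core hornerD hornerN hornerZ hornerM horner_exp hornerC.
rewrite horner_cubic_poly mulrA /node_poly horner_prod; congr (_ * _ ^+ 2 * _ - _).
by apply: eq_bigr => a _; rewrite hornerXsubC.
Qed.

Lemma size_root_poly (R : fieldType) : 4 != 0 :> R -> size (root_poly R) = (2 * m + 4)%N.
Proof.
move=> four; have s4 : size (4%:R *: root_poly_core R) = (2 * m + 4)%N.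
  by rewrite size_scale // size_root_poly_core.
rewrite /root_poly size_polyDl ?s4 // size_polyN.
by rewrite (leq_ltn_trans (size_polyC_leq1 _)) // !addnS.
Qed.

(* The constant term does not affect the two coefficients below the leading one *)
Lemma sum_roots_sqr (F : fieldType) (s : seq F) : 4 != 0 :> F ->
  root_poly F = 4 *: \prod_(a <- s) ('X - a%:P) ->
  \sum_(a <- s) a ^+ 2 = 2 * \sum_(a <- root_nodes F) a ^+ 2 - (39 * D ^ 2)%:R.
Proof.
move=> four fE; rewrite -(root_squares_prod1 s).
have ss : size s = (2 * m + 3)%N.
  by have := size_root_poly four; rewrite fE size_scale // size_prod_XsubC addnS => -[].
have -> : \prod_(a <- s) ('X - a%:P) = root_poly_core F - ((3 * D ^ 3)%:R / 4)%:P.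
  apply: (scalerI four); rewrite -fE scalerBr /root_poly -[_ *: (_ / _)%:P]mul_polyC -polyCM.
  by rewrite [4 * _]mulrC divfK.
transitivity (root_squares (size s) (root_poly_core F)).
  by rewrite ss /root_squares !mulrBr !coefB !coefMC !coefXn !addnS /= !mul0r !subr0.
rewrite ss root_squares_core -addrA; congr (_ + _).
by rewrite -opprB -natrB ?leq_mul2r ?orbT // -mulnBl.
Qed.
End RootPolynomial.
Lemma ivt_roots (R : rcfType) (P : {poly R}) (t : nat -> R) n :
  (forall k, (k < n)%N -> t k < t k.+1) ->
  (forall k, (k < n)%N -> P.[t k] * P.[t k.+1] < 0) ->
  exists z : nat -> R, (forall k, (k < n)%N -> root P (z k)) /\
    {in gtn n &, injective z}.
Proof.
move=> t_lt Pt.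
have /choice[z zP] k : exists x, (k < n)%N -> [/\ t k < x, x < t k.+1 & root P x].
  have [kn|_] := boolP (k < n)%N; last by exists 0.
  have [x /andP[x1 x2] Px] : exists2 x, t k <= x <= t k.+1 & root (P.[t k.+1] *: P) x.
    apply: poly_ivt; first exact/ltW/t_lt.
    rewrite !hornerZ.
    by apply/andP; split; [rewrite mulrC; apply/ltW/Pt | rewrite -expr2 sqr_ge0].
  have P0 := Pt k kn; move: Px; rewrite rootZ; last first.
    by apply: contraTneq P0 => ->; rewrite mulr0 ltxx.
  move=> Px; exists x => _; split=> //; rewrite lt_neqAle ?x1 ?x2 andbT; apply: contraTneq P0.
    by move=> ->; rewrite (rootP Px) mul0r ltxx.
  by move=> <-; rewrite (rootP Px) mulr0 ltxx.
have t_le k l : (k <= l)%N -> (l <= n)%N -> t k <= t l.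
  elim: l => [|l IHl]; first by rewrite leqn0 => /eqP ->.
  rewrite leq_eqVlt => /orP[/eqP -> //|kl] ln.
  by apply: le_trans (IHl kl (ltnW ln)) _; apply/ltW/t_lt.
have z_lt k l : (k < l)%N -> (l < n)%N -> z k < z l.
  move=> kl ln; have [_ zk _] := zP k (ltn_trans kl ln); have [zl _ _] := zP l ln.
  by rewrite (lt_trans zk) // (le_lt_trans _ zl) // t_le // ltnW.
exists z; split=> [k /zP[]//|k l kn ln zkl].
by case: (ltngtP k l) => // /z_lt; rewrite zkl ltxx => /(_ _); [move/(_ ln)|move/(_ kn)].
Qed.

Section RealRoots.
Variables (m D : nat) (R : rcfType).
Hypothesis D0 : (0 < D)%N.

Definition test_point k : R :=
  if k is 0 then - (3 * D)%:R else (3 * k./2 + odd k)%:R.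

Lemma root_poly_node j : (0 < j <= m)%N -> (root_poly m D R).[(3 * j)%:R] < 0.
Proof.
case: j => // j /= jm; rewrite horner_root_poly (_ : \prod_(_ <- _) _ = 0).
  by rewrite expr0n mulr0 mul0r sub0r oppr_lt0 ltr0n muln_gt0 expn_gt0 D0.
apply/eqP; rewrite prodf_seq_eq0; apply/hasP; exists ((3 * j.+1)%:R).
  by apply: map_f; rewrite mem_iota.
by rewrite subrr /=.
Qed.

Lemma root_poly_between j : 0 < (root_poly m D R).[(3 * j + 1)%:R].
Proof.
rewrite horner_root_poly; set q := _ + _ + _ + _.
have qD : (48 * D ^ 3)%:R <= q by rewrite ler_wpDl // !addr_ge0 ?mulr_ge0 ?exprn_ge0 ?ler0n.
have P1 : 1 <= (\prod_(a <- root_nodes m R) ((3 * j + 1)%:R - a)) ^+ 2.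
  rewrite -prodrXl big_map; elim: (iota 0 m) => [|k s IHs]; first by rewrite big_nil.
  rewrite big_cons mulr_ege1 //.
  have -> : (3 * j + 1)%:R - (3 * k.+1)%:R = ((3 * j + 1)%:Z - (3 * k.+1)%:Z)%:~R :> R.
    by rewrite rmorphB /=.
  rewrite -rmorphXn /= -[1]/(1%:~R) ler_int -gtz0_ge1 exprn_even_gt0 //= subr_eq0.
  by apply/eqP => -[] /(congr1 (modn^~ 3)); rewrite mulnC modnMDl mulnC modnMl.
rewrite subr_gt0 (@lt_le_trans _ _ (4 * 1 * (48 * D ^ 3)%:R)) //.
  by rewrite mulr1 -natrM ltr_nat mulnA ltn_pmul2r ?expn_gt0 ?D0.
by rewrite ler_pM ?mulr_ge0 ?ler0n // ler_wpM2l ?ler0n.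
Qed.

Lemma root_poly_left : (root_poly m D R).[- (3 * D)%:R] < 0.
Proof.
rewrite horner_root_poly.
have -> : (- (3 * D)%:R) ^+ 3 + (3 * D)%:R * (- (3 * D)%:R) ^+ 2 +
    (24 * D ^ 2)%:R * - (3 * D)%:R + (48 * D ^ 3)%:R = - (24 * D ^ 3)%:R :> R by ring.
rewrite mulrN -opprD oppr_lt0 ltr_wpDl //.
  by rewrite mulr_ge0 ?ler0n // mulr_ge0 ?ler0n // sqr_ge0.
by rewrite ltr0n muln_gt0 expn_gt0 D0.
Qed.

Lemma root_poly_real_roots : exists z : 'I_(2 * m).+1 -> R,
  injective z /\ forall k, root (root_poly m D R) (z k).
Proof.
have sgn k : (k <= (2 * m).+1)%N -> if odd k then 0 < (root_poly m D R).[test_point k]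
    else (root_poly m D R).[test_point k] < 0.
  case: k => [_|k km]; first exact: root_poly_left.
  case: ifPn => ok; rewrite /test_point.
    by rewrite ok; apply: root_poly_between.
  rewrite (negPf ok) addn0; apply: root_poly_node; rewrite half_gt0 /=.
  have := odd_double_half k.+1; rewrite (negPf ok) add0n -mul2n => kE.
  move: km; rewrite -kE; lia.
have [||z [zr z_inj]] := @ivt_roots R (root_poly m D R) test_point (2 * m).+1.
- move=> [_|k _]; first by rewrite /test_point /= (lt_trans _ (ltr01)) // oppr_lt0 ltr0n muln_gt0.
  rewrite /test_point ltr_nat; lia.
- move=> k kn; have := sgn k (ltnW kn); have := sgn k.+1 kn => /=.
  by case: (odd k) => /= s1 s2; [rewrite pmulr_rlt0 | rewrite nmulr_rlt0].
exists z; split=> [k l /z_inj kl|k]; last exact: zr.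
by apply/val_inj/kl; rewrite inE ltn_ord.
Qed.
End RealRoots.

Section Transposition.
Variables (m D : nat) (L : splittingFieldType rat) (LtoC : {rmorphism L -> algC}).
Variable r : 'I_(2 * m + 3) -> L.
Hypothesis r_inj : injective r.
Hypothesis r_roots : root_poly m D L = 4 *: \prod_i ('X - (r i)%:P).
Hypothesis D_gt0 : (0 < D)%N.
Hypothesis D_large : (2 * \sum_(j <- iota 0 m) (3 * j.+1) ^ 2 < 39 * D ^ 2)%N.

Let f_roots : map_poly (in_alg L) (root_poly m D rat) %= \prod_i ('X - (r i)%:P).
Proof.
rewrite map_root_poly r_roots eqp_scale // -(rmorph_nat (in_alg L)) fmorph_eq0.
by rewrite pnatr_eq0.
Qed.

Lemma root_poly_algC_root x : root (root_poly m D algC) x -> exists i, x = LtoC (r i).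
Proof.
rewrite -(map_root_poly m D LtoC) r_roots map_polyZ rootZ; last first.
  by rewrite rmorph_nat pnatr_eq0.
rewrite rmorph_prod /= /root horner_prod prodf_seq_eq0 => /hasP[i _].
rewrite rmorphB /= map_polyX map_polyC /= hornerXsubC subr_eq0 => /eqP ->.
by exists i.
Qed.

Lemma exists_nonreal_root : exists i, LtoC (r i) \isn't Num.real.
Proof.
apply: contrapT => /forallNP real_r.
have sum_r : \sum_i LtoC (r i) ^+ 2 =
    (2 * \sum_(j <- iota 0 m) (3 * j.+1) ^ 2)%:R - (39 * D ^ 2)%:R.
  have four : 4 != 0 :> L by rewrite -(rmorph_nat (in_alg L)) fmorph_eq0 pnatr_eq0.
  have := @sum_roots_sqr m D L (codom r) four.
  rewrite !big_image /= => /(_ r_roots) /(congr1 LtoC).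
  rewrite rmorph_sum rmorphB rmorphM !rmorph_nat rmorph_sum /= big_map => e.
  under eq_bigr do rewrite -rmorphXn; rewrite e [in RHS]natrM natr_sum; congr (2 * _ - _).
  by apply: eq_bigr => j _; rewrite rmorphXn /= rmorph_nat natrX.
have : 0 <= \sum_i LtoC (r i) ^+ 2.
  by apply: sumr_ge0 => i _; rewrite real_exprn_even_ge0 //; apply/negPn/negP/real_r.
by rewrite sum_r subr_ge0 ler_nat leqNgt D_large.
Qed.

Lemma exists_transposition : exists t i0 j0,
  i0 != j0 /\ gal_perm r t (tperm i0 j0).
Proof.
have [nu nuE] := restrict_aut_to_normal_num_field LtoC Num.conj.
have [t tE] := gal_of_lrmorphism nu.
have [s ts] := gal_perm_exists r_inj f_roots t.
have conj_r i : (LtoC (r i))^* = LtoC (r (s i)) by rewrite -ts tE nuE.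
have [i0 i0_nonreal] := exists_nonreal_root.
have real_fix i : LtoC (r i) \is Num.real -> s i = i.
  by rewrite CrealE conj_r => /eqP/fmorph_inj/r_inj.
have nonreal_s i : LtoC (r i) \isn't Num.real -> LtoC (r (s i)) \isn't Num.real.
  by rewrite !CrealE -conj_r conjCK eq_sym.
have nonreal_move i : LtoC (r i) \isn't Num.real -> s i != i.
  by apply: contra => /eqP si; rewrite CrealE conj_r si.
pose S := [set i | LtoC (r i) \is Num.real].
have cardS : (2 * m < #|S|)%N.
  have [z [z_inj z_root]] := root_poly_real_roots m algR D_gt0.
  have /choice[g gE] k : exists i, algRval (z k) = LtoC (r i).
    by apply: root_poly_algC_root; rewrite -(map_root_poly m D algRval) fmorph_root.
  have g_inj : injective g.
    by move=> k l gkl; apply/z_inj/val_inj; rewrite /= !gE gkl.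
  have gS : g @: [set: 'I_(2 * m).+1] \subset S.
    by apply/subsetP => _ /imsetP[k _ ->]; rewrite inE -gE algRvalP.
  by move/subset_leq_card: gS; rewrite card_imset // cardsT card_ord.
exists t, i0, (s i0); split; first by rewrite eq_sym nonreal_move.
have nonrealE i : LtoC (r i) \isn't Num.real -> i = i0 \/ i = s i0.
  move=> ir; have /eqP SE : [set i0; s i0] == ~: S.
    rewrite eqEcard cards2 eq_sym nonreal_move // cardsCs setCK card_ord.
    rewrite subUset !sub1set !inE i0_nonreal nonreal_s //; lia.
  have : i \in ~: S by rewrite !inE.
  by rewrite -SE !inE => /orP[] /eqP; [left | right].
suff <- : s = tperm i0 (s i0) by [].
apply/permP => i; have [ireal|inonreal] := boolP (LtoC (r i) \is Num.real).
  rewrite real_fix // tpermD //; apply: contraTneq ireal => <- //.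
  exact: nonreal_s.
case: (nonrealE i inonreal) => ->; first by rewrite tpermL.
by rewrite tpermR; apply: r_inj; apply: (fmorph_inj LtoC); rewrite -conj_r -conj_r conjCK.
Qed.
End Transposition.
Section DyadicRoots.
Variables (L : fieldType) (R : subringClosed L).
Hypothesis R_total : forall x, (x \in R) || (x^-1 \in R).
Hypothesis R2 : nonunit R 2.

Lemma odd_unit n : odd n -> ~~ nonunit R n%:R.
Proof.
move=> n_odd; rewrite -(odd_double_half n) n_odd natrD -muln2 natrM addrC.
apply: nonunit_unitD => //; last exact: nonunit1.
by rewrite mulrC nonunitM // rpred_nat.
Qed.

Lemma nonunitX_inv x n : nonunit R (x ^+ n) -> nonunit R x.
Proof. by apply: contraTT => /unitX. Qed.

Lemma dyadic_split n : (0 < n)%N -> exists2 u : L,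
  u \in R /\ ~~ nonunit R u & n%:R = 2 ^+ logn 2 n * u.
Proof.
move=> n0; exists ((n`_2^')%N)%:R; last by rewrite -natrX -natrM -p_part partnC.
split; first exact: rpred_nat.
by apply: odd_unit; rewrite odd_2'nat part_pnat.
Qed.

Lemma dyadic_uniq i j (u v : L) : 2 != 0 :> L -> u \in R -> v \in R ->
  ~~ nonunit R u -> ~~ nonunit R v -> 2 ^+ i * u = 2 ^+ j * v -> i = j.
Proof.
move=> two0; wlog ij : i j u v / (i <= j)%N => [wlog_ij|] Ru Rv uu uv e.
  case/orP: (leq_total i j) => ij; first exact: wlog_ij e.
  by apply/esym/(wlog_ij j i v u).
move: e; rewrite -(subnKC ij) exprD -mulrA => /(mulfI (expf_neq0 _ two0)) e.
case: (j - i)%N e => [|k e]; first by rewrite addn0.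
by case/negP: uu; rewrite e exprS -mulrA nonunitM // rpredM ?rpredX ?rpred_nat.
Qed.

Variables m D : nat.
Hypothesis D_odd : odd D.

Lemma root_poly_root_inv x : root (root_poly m D L) x -> [/\ x != 0, nonunit R x^-1 &
  exists2 u : L, u \in R /\ ~~ nonunit R u & x^-1 ^+ (2 * m + 3) = 4 * u].
Proof.
rewrite /root horner_root_poly subr_eq0 => /eqP fx.
have R2' := nonunit_in R_total R2.
have uD : ~~ nonunit R (3 * D ^ 3)%:R by apply: odd_unit; rewrite oddM oddX D_odd.
have Rx : x \notin R.
  apply: contra uD => Rx; rewrite -fx -!mulrA (natrM _ 2 2) -mulrA nonunitM //.
  by rewrite /root_nodes big_map; solve_rpred; apply: rpred_prod => k _; solve_rpred.
have x0 : x != 0 by apply/eqP => x0; case/negP: Rx; rewrite x0 rpred0.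
have my : nonunit R x^-1 by rewrite /nonunit invrK Rx orbT.
split=> //; set y := x^-1 in my *; have Ry := nonunit_in R_total my.
pose C := \prod_(a <- root_nodes m L) (1 - a * y).
pose E := 1 + y * ((3 * D)%:R + (24 * D ^ 2)%:R * y + (48 * D ^ 3)%:R * y ^+ 2).
have uC : C \in R /\ ~~ nonunit R C.
  rewrite /C /root_nodes big_map; elim: (iota 0 m) => [|k s [IHR IHu]].
    by rewrite big_nil rpred1 nonunit1.
  rewrite big_cons rpredM ?rpredB ?rpred1 ?rpredM ?rpred_nat //; split=> //.
  apply: unitM => //; rewrite addrC; apply: nonunit_unitD; rewrite ?nonunit1 //.
  by rewrite nonunitN mulrC nonunitM // rpred_nat.
have uE : E \in R /\ ~~ nonunit R E.
  have Rc : (3 * D)%:R + (24 * D ^ 2)%:R * y + (48 * D ^ 3)%:R * y ^+ 2 \in R.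
    by rewrite !rpredD ?rpredM ?rpredX ?rpred_nat.
  split; first by rewrite rpredD ?rpred1 ?rpredM.
  by rewrite /E addrC; apply: nonunit_unitD; rewrite ?nonunit1 ?nonunitM.
have [D0 RD] := unit_inv uD.
have [[RC uC'] [RE uE']] := (uC, uE).
exists (C ^+ 2 * E / (3 * D ^ 3)%:R).
  split; first by rewrite !rpredM ?rpredX.
  by rewrite !unitM ?unitX ?unitV ?rpred_nat.
have CE : (\prod_(a <- root_nodes m L) (x - a)) * y ^+ m = C.
  rewrite /C /root_nodes !big_map.
  have -> : y ^+ m = \prod_(k <- iota 0 m) y.
    by rewrite big_const_seq count_predT size_iota iter_mulr_1.
  rewrite -big_split /=; apply: eq_bigr => k _.
  by rewrite mulrBl mulfV.
have -> : E = (x ^+ 3 + (3 * D)%:R * x ^+ 2 + (24 * D ^ 2)%:R * x + (48 * D ^ 3)%:R) * y ^+ 3.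
  by rewrite /E /y; field.
rewrite -CE mulrA; apply: (canRL (mulfK D0)); rewrite -[in LHS]fx mul2n -addnn !exprD.
by ring.
Qed.

(* The roots all have 2-adic valuation - 2 / (2 m + 3); the constant coefficient
   of a rational factor of degree d has valuation - 2 d / (2 m + 3), an integer *)
Lemma root_poly_irreducible (iota : {rmorphism rat -> L}) (s : seq L) :
  prime (2 * m + 3) -> root_poly m D L = 4 *: \prod_(a <- s) ('X - a%:P) ->
  irreducible_poly (root_poly m D rat).
Proof.
set p := (2 * m + 3)%N => p_prime fE.
have natr0 n : (0 < n)%N -> n%:R != 0 :> L.
  by move=> n0; rewrite -(rmorph_nat iota) fmorph_eq0 pnatr_eq0 -lt0n.
have sz : size (root_poly m D rat) = p.+1 by rewrite size_root_poly ?pnatr_eq0 // /p !addnS.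
split=> [|g sg gf]; first by rewrite sz ltnS prime_gt0.
have g0 : g != 0.
  by apply: contraTneq gf => ->; rewrite dvd0p -size_poly_eq0 sz.
rewrite -(dvdp_size_eqp gf) sz; pose d := (size g).-1.
have sgd : size g = d.+1 by rewrite prednK // size_poly_gt0.
have d0 : (0 < d)%N by rewrite lt0n -eqSS -sgd.
have dp : (d <= p)%N by rewrite -ltnS -sgd -sz dvdp_leq // -size_poly_eq0 sz.
rewrite sgd eqSS eqn_leq dp /=.
have : map_poly iota g %| \prod_(a <- s) ('X - a%:P).
  rewrite -(@dvdpZr _ 4) ?natr0 // -fE -(map_root_poly m D iota).
  by rewrite dvdp_map.
case/dvdp_prod_XsubC => mk gE; set t := mask mk s in gE.
have st : size t = d.
  have := eqp_size gE; rewrite size_map_poly sgd size_prod_XsubC => -[] //.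
have t_root x : x \in t -> root (root_poly m D L) x.
  move=> /mem_mask xs; rewrite fE rootZ ?natr0 // root_prod_XsubC //.
pose N := \prod_(a <- t) (- a).
have [c NE] : exists c : rat, N = iota c.
  have /eqpP[[b1 b2] /= /andP[b10 b20] e] := gE.
  have hm : \prod_(a <- t) ('X - a%:P) \is monic := monic_prod_XsubC _ _ _.
  have b2E : b2 = b1 * iota (lead_coef g).
    have := congr1 lead_coef e; rewrite !lead_coefZ lead_coef_map.
    by rewrite (monicP hm) mulr1.
  exists (g`_0 / lead_coef g).
  have -> : N = (\prod_(a <- t) ('X - a%:P))`_0.
    rewrite -horner_coef0 horner_prod; apply: eq_bigr => a _.
    by rewrite hornerXsubC sub0r.
  apply: (mulfI b20); rewrite -coefZ -e coefZ coef_map b2E fmorph_div /=.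
  by field; rewrite fmorph_eq0 lead_coef_eq0.
have [u [Ru uu] yE] : exists2 u, u \in R /\ ~~ nonunit R u & N^-1 ^+ p = 4 ^+ d * u.
  rewrite /N -st; elim: (t) t_root => [|x t' IHt] t_root.
    by exists 1; rewrite ?rpred1 ?nonunit1 // big_nil invr1 expr1n mulr1.
  have [|v [Rv uv] IH] := IHt; first by move=> z zt; apply: t_root; rewrite inE zt orbT.
  have [|_ _ [w [Rw uw] wE]] := @root_poly_root_inv x; first by apply: t_root; rewrite mem_head.
  rewrite -/p in wE; exists ((-1) ^+ p * w * v).
    split; first by solve_rpred; rewrite rpredN rpred1.
    by rewrite !unitM ?unitX // nonunitN nonunit1.
  by rewrite big_cons invfM exprMn IH invrN [(- x^-1) ^+ p]exprNn wE /= exprS; ring.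
have N0 : N != 0.
  rewrite prodf_seq_neq0; apply/allP => x /t_root/root_poly_root_inv[x0 _ _] /=.
  by rewrite oppr_eq0.
have c0 : c != 0 by apply: contraNneq N0 => c0; rewrite NE c0 rmorph0.
have abs_sqr (z : int) : z%:~R ^+ 2 = `|z|%N%:R ^+ 2 :> L.
  by rewrite {1}[z]intEsign rmorphM /= rmorph_sign exprMn sqrr_sign mul1r.
have [|v [Rv uv] vE] := @dyadic_split `|numq c|; first by rewrite absz_gt0 numq_eq0.
have [|w [Rw uw] wE] := @dyadic_split `|denq c|; first by rewrite absz_gt0 denq_neq0.
set i := logn 2 _ in vE; set j := logn 2 _ in wE.
have : 2 ^+ (2 * p * j) * w ^+ (2 * p) = 2 ^+ (4 * d + 2 * p * i) * (u ^+ 2 * v ^+ (2 * p)).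
  have nq0 : (numq c)%:~R != 0 :> L.
    by rewrite -(rmorph_int iota) fmorph_eq0 intr_eq0 numq_eq0.
  have dq0 : (denq c)%:~R != 0 :> L.
    by rewrite -(rmorph_int iota) fmorph_eq0 intr_eq0 denq_neq0.
  have e : (denq c)%:~R ^+ p = 4 ^+ d * u * (numq c)%:~R ^+ p :> L.
    have cE : iota c = (numq c)%:~R / (denq c)%:~R.
      by rewrite -{1}(divq_num_den c) fmorph_div !rmorph_int.
    by rewrite -yE NE cE invf_div expr_div_n divfK // expf_neq0.
  transitivity (((denq c)%:~R ^+ 2) ^+ p : L).
    by rewrite abs_sqr wE -exprM exprMn -exprM [(j * _)%N]mulnC.
  rewrite exprAC e; transitivity ((4 ^+ 2) ^+ d * u ^+ 2 * ((numq c)%:~R ^+ 2) ^+ p).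
    by rewrite !exprMn -!expr2.
  rewrite abs_sqr vE (_ : 4 ^+ 2 = 2 ^+ 4) -?[(2 ^+ 4) ^+ d]exprM; last by ring.
  rewrite -exprM exprMn -exprM [(i * _)%N]mulnC exprD mulrACA; congr (_ * _ * _).
move/(dyadic_uniq (natr0 2%N isT)); rewrite rpredX // rpredM ?rpredX // unitX //.
move=> /(_ isT isT isT (unitM (unitX _ uu) (unitX _ uv))) e.
have {}e : (p * j = 2 * d + p * i)%N.
  by apply/eqP; rewrite -(eqn_pmul2l (isT : 0 < 2)%N) mulnDr !mulnA; apply/eqP.
have : (p %| 2 * d)%N.
  by rewrite -(dvdn_addl _ (dvdn_mulr i (dvdnn p))) -e dvdn_mulr.
rewrite Gauss_dvdr; first by move=> /dvdn_leq; apply.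
by rewrite coprime_sym coprime2n /p oddD mul2n odd_double.
Qed.

Lemma near_zero_chart (w t : L) (q : projpt L 2) : w != 0 -> t != 0 ->
  nonunit R w^-1 -> chart_rel w t -> val q = <[chart w t]>%VS ->
  exists z, near_zero R z q.
Proof.
move=> w0 t0 mw wt qE; have Rw := nonunit_in R_total mw; have R2' := nonunit_in R_total R2.
pose k := w / t.
have mk : nonunit R k.
  have u3 : ~~ nonunit R 3 by apply: (@odd_unit 3).
  pose h := 1 + w^-1 * (3 + 24 * w^-1 + 48 * w^-1 ^+ 2).
  have Rh : 3 + 24 * w^-1 + 48 * w^-1 ^+ 2 \in R by solve_rpred.
  have uh : ~~ nonunit R h.
    by rewrite /h addrC; apply: nonunit_unitD; rewrite ?nonunit1 ?nonunitM.
  have [h0 Rh'] := unit_inv uh.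
  have k2 : k ^+ 2 = w^-1 * (3 / h).
    have e : 3 * t ^+ 2 = w ^+ 3 * h.
      by move/eqP: wt; rewrite chart_polyE => ->; rewrite /h; field.
    have nz : w ^+ 3 * h != 0 by rewrite mulf_neq0 ?expf_neq0.
    apply: (mulIf nz); transitivity (3 * w ^+ 2); first by rewrite -e /k; field.
    by move: (h) h0 => h' h'0; field; rewrite w0 h'0.
  by apply: (@nonunitX_inv _ 2); rewrite k2 nonunitM // rpredM ?rpred_nat.
pose tau := t^-1.
have tauE : tau = k * w^-1 by rewrite /tau /k mulrAC mulfV // mul1r.
have mtau : nonunit R tau by rewrite tauE nonunitM.
pose X := 1 + (4 * tau - k).
have mX : nonunit R (4 * tau - k).
  by apply: nonunitD; rewrite ?nonunitN // mulrC nonunitM ?rpred_nat.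
have uX : ~~ nonunit R X by rewrite /X addrC; apply: nonunit_unitD; rewrite ?nonunit1.
exists (- (4 * tau + k) / X); apply: (@near_zero_vline _ _ _ X (4 * tau - k)) => //.
- by rewrite nonunitN; apply: nonunitD; rewrite // mulrC nonunitM ?rpred_nat.
- exact: nonunit_in.
rewrite qE -(vline_scale _ (invr_neq0 t0)) scale_row3; congr (<[row3 _ _ _]>%VS).
- by rewrite /X /tau /k; field.
- by rewrite /X /tau /k; field.
by rewrite /tau /k; field.
Qed.
End DyadicRoots.

Lemma chart_inj (F : fieldType) (w t w' t' : F) : 2 != 0 :> F ->
  <[chart w t]>%VS = <[chart w' t']>%VS -> chart w' t' != 0 -> w = w'.
Proof.
move=> two e c0; have [c _ cE] := vline_eqP c0 e.
have c1 : c = 1.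
  apply: (mulfI (expf_neq0 4 two)); rewrite mulr1.
  transitivity ((c *: chart w' t') 0 0 + (c *: chart w' t') 0 1 - (c *: chart w' t') 0 2).
    by rewrite !mxE /=; ring.
  by rewrite -cE !mxE /=; ring.
have /rowP/(_ 2) := cE; rewrite c1 scale1r !mxE /= => /oppr_inj/addrI.
exact: mulfI.
Qed.
Lemma pchar0_galois (F : fieldType) (L : splittingFieldType F) :
  [pchar L] =i pred0 -> galois 1%AS {:L}.
Proof.
move=> char0; apply/and3P; split; [exact: sub1v | | exact: normalFieldf].
by apply/separableP => y _; apply: pcharf0_separable.
Qed.

Lemma irreducible_separable (F : numFieldType) (f : {poly F}) :
  irreducible_poly f -> separable_poly f.
Proof.
move=> [f_gt1 f_min]; rewrite unlock /coprimep; apply/negPn/negP => /f_min.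
move=> /(_ (dvdp_gcdl _ _)) gf; have f_dvd : f %| f^`().
  by rewrite -(eqp_dvdl _ gf) dvdp_gcdr.
have [n sf] : exists n, size f = n.+2 by case: (size f) f_gt1 => [|[|n]] //; exists n.
have f'0 : f^`() != 0.
  apply/eqP => /polyP/(_ n); rewrite coef_deriv coef0 => /eqP.
  rewrite mulrn_eq0 /= -[n.+1]/(n.+2.-1) -sf -lead_coefE lead_coef_eq0.
  by rewrite -size_poly_eq0 sf.
have := dvdp_leq f'0 f_dvd; rewrite leqNgt lt_size_deriv //.
by rewrite -size_poly_eq0 sf.
Qed.

Lemma symmetric_number_field m : prime (2 * m + 3) ->
  exists (D : nat) (L : splittingFieldType rat) (r : 'I_(2 * m + 3) -> L),
  [/\ odd D, injective r, root_poly m D L = 4 *: \prod_i ('X - (r i)%:P),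
      <<1 & codom r>>%VS = fullv & forall sigma, exists s, gal_perm r s sigma].
Proof.
move=> p_prime; pose D := (2 * m ^ 2).+1.
have D_odd : odd D by rewrite /= oddM.
have D_large : (2 * \sum_(j <- iota 0 m) (3 * j.+1) ^ 2 < 39 * D ^ 2)%N.
  have : (\sum_(j <- iota 0 m) (3 * j.+1) ^ 2 <= \sum_(j <- iota 0 m) (3 * m) ^ 2)%N.
    rewrite !big_seq leq_sum // => j; rewrite mem_iota => jm.
    by rewrite leq_exp2r // leq_mul2l.
  rewrite -[X in (_ <= \sum_(j <- iota 0 X) _)%N](subn0 m) sum_nat_const_nat subn0 /D => le_sum.
  by apply: leq_ltn_trans (leq_mul (leqnn 2) le_sum) _; nia.
have [s sE] := closed_field_poly_normal (root_poly m D algC).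
have sz : size (root_poly m D algC) = (2 * m + 3).+1.
  by rewrite size_root_poly ?pnatr_eq0 // !addnS.
have lc : lead_coef (root_poly m D algC) = 4.
  rewrite lead_coefE sz coefB coefZ coefC addnS subr0 -addnS.
  by rewrite (monic_coef_size (root_poly_core_monic _ _ _)) ?size_root_poly_core ?addnS // mulr1.
rewrite {}lc in sE.
have [Q [QtoC [t ts tgen]]] := num_field_exists s.
have tE : root_poly m D Q = 4 *: \prod_(a <- t) ('X - a%:P).
  apply: (map_poly_inj QtoC); rewrite map_root_poly sE -ts map_polyZ rmorph_nat.
  rewrite rmorph_prod big_map; congr (_ *: _); apply: eq_bigr => a _.
  by rewrite rmorphB /= map_polyX map_polyC.
have four : 4 != 0 :> Q by rewrite -(rmorph_nat (in_alg Q)) fmorph_eq0 pnatr_eq0.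
have Q_split : SplittingField.axiom Q.
  exists (root_poly m D Q).
    rewrite -(map_root_poly m D (in_alg Q)); apply/polyOver1P.
    by exists (root_poly m D rat).
  by exists t; rewrite // tE eqp_scale.
pose L : splittingFieldType rat :=
  HB.pack Q (FieldExt_isSplittingField.Build rat Q Q_split).
have st : size t = (2 * m + 3)%N.
  have := size_root_poly m D four; rewrite tE size_scale // size_prod_XsubC !addnS.
  by move=> -[].
pose r (i : 'I_(2 * m + 3)) : L := t`_i.
have rE : root_poly m D L = 4 *: \prod_i ('X - (r i)%:P).
  rewrite [LHS]tE; congr (_ *: _).
  by rewrite (big_nth 0) st big_mkord.
have f_irr : irreducible_poly (root_poly m D rat).
  have [n|R [R_total R2]] := @exists_valuation_ring Q.
    by rewrite -(rmorph_nat (in_alg Q)) fmorph_eq0 pnatr_eq0.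
  apply: (@root_poly_irreducible Q R R_total _ m D D_odd (in_alg Q) t) => //.
  by rewrite /nonunit R2 orbT.
have f_roots : map_poly (in_alg L) (root_poly m D rat) %= \prod_i ('X - (r i)%:P).
  by rewrite map_root_poly rE eqp_scale.
have r_inj : injective r.
  have t_uniq : uniq t.
    have := irreducible_separable f_irr.
    rewrite -(separable_map (in_alg Q)) map_root_poly tE -separable_prod_XsubC.
    by rewrite (eqp_separable (eqp_scale _ four)).
  move=> i j /eqP; rewrite nth_uniq ?st // => /eqP; exact: val_inj.
exists D, L, r; split=> //.
  rewrite -[RHS]tgen; congr <<1 & _>>%VS.
  by rewrite /codom /image_mem -[RHS](mkseq_nth 0) st /mkseq -val_enum_ord -map_comp.
have [u [i0 [j0 [ij uE]]]] := @exists_transposition m D L QtoC r r_inj rE isT D_large.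
exact: (gal_perm_surj r_inj f_irr f_roots p_prime ij uE).
Qed.

Lemma gal_perm_id (F : fieldType) (L : splittingFieldType F) p (r : 'I_p -> L)
    (s : gal_of {:L}) :
  <<1 & codom r>>%VS = fullv -> gal_perm r s 1%g -> s = 1%g.
Proof.
move=> r_gen sr; apply/eqP/gal_eqP => x _; rewrite gal_id.
suff : (<<1 & codom r>> <= fixedSpace s)%VS.
  by rewrite r_gen => /subvP/(_ x (memvf x))/fixedSpaceP.
apply/Fadjoin_seqP; split; first exact: sub1v.
by move=> _ /codomP[i ->]; apply/fixedSpaceP; rewrite sr perm1.
Qed.

(** * Galois groups over intermediate fields *)

Section FieldOver.
Variables (F : fieldType) (L : splittingFieldType F) (E : {subfield L}).

Lemma gal_fieldOver_down (s : gal_of {:fieldOver E}) :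
  exists2 s0 : gal_of {:L}, s0 \in 'Gal({:L} / E)%g & forall x : L, s0 x = s x.
Proof.
pose f (x : L) : L := s x.
have fE (x : L) : x \in E -> f x = x.
  move=> Ex; have xE : x = in_alg (fieldOver E) (vsproj E x).
    by rewrite /= fieldOver_scaleE vsprojK //; apply/esym/(mulr1 x).
  have : s (in_alg _ (vsproj E x)) = in_alg _ (vsproj E x) by rewrite /= linearZ /= rmorph1.
  by rewrite -xE.
have fz : zmod_morphism f by move=> x y; apply: (rmorphB (s : {rmorphism _ -> _})).
have fm : monoid_morphism f.
  split; first exact: (rmorph1 (s : {rmorphism _ -> _})).
  by move=> x y; apply: (rmorphM (s : {rmorphism _ -> _})).
have fs : scalable f.
  move=> a x; rewrite -mulr_algl (fm.2 a%:A x) fE ?mulr_algl //.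
  by rewrite memvZ // mem1v.
pose g : {lrmorphism L -> L} := HB.pack f (GRing.isZmodMorphism.Build L L f fz)
  (GRing.isMonoidMorphism.Build L L f fm) (GRing.isScalable.Build F L L *:%R f fs).
have [s0 s0E] := gal_of_lrmorphism g; exists s0; last by move=> x; rewrite s0E.
rewrite gal_kHom ?subvf //; apply/kAHomP => x Ex; rewrite s0E; exact: fE.
Qed.

Lemma gal_fieldOver_up (s0 : gal_of {:L}) : s0 \in 'Gal({:L} / E)%g ->
  exists s : gal_of {:fieldOver E}, forall x : L, s x = s0 x.
Proof.
rewrite gal_kHom ?subvf // => /kAHomP s0E; pose f (x : fieldOver E) : fieldOver E := s0 x.
have fz : zmod_morphism f by move=> x y; apply: (rmorphB (s0 : {rmorphism _ -> _})).
have fm : monoid_morphism f.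
  split; first exact: (rmorph1 (s0 : {rmorphism _ -> _})).
  by move=> x y; apply: (rmorphM (s0 : {rmorphism _ -> _})).
have fs : scalable f.
  move=> a x; rewrite !fieldOver_scaleE (fm.2 (vsval a) x); congr (_ * _).
  by apply: s0E; apply: subvsP.
pose g : {lrmorphism fieldOver E -> fieldOver E} := HB.pack f
  (GRing.isZmodMorphism.Build _ _ f fz) (GRing.isMonoidMorphism.Build _ _ f fm)
  (GRing.isScalable.Build _ _ _ *:%R f fs).
by have [s sE] := gal_of_lrmorphism g; exists s => x; rewrite sE.
Qed.
End FieldOver.
(** * The conjugate points *)

Lemma val_base_change (F F' : fieldType) (f : {rmorphism F -> F'}) n
    (q : projpt F n) (u : 'rV[F]_n.+1) :
  u != 0 -> val q = <[u]>%VS -> val (base_change_pt f q) = <[map_mx f u]>%VS.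
Proof.
move=> u0 qE; have [c c0 cE] : exists2 c, c != 0 & coords q = c *: u.
  by apply: vline_eqP => //; rewrite coordsK.
by rewrite /= cE map_mxZ vline_scale ?fmorph_eq0.
Qed.

Section BaseChangeHesse.
Variables (F F' : fieldType) (f : {rmorphism F -> F'}).
Hypotheses (six : 6%:R != 0 :> F) (six' : 6%:R != 0 :> F').

Lemma on_hesse_base_change q : on_hesse q -> on_hesse (base_change_pt f q).
Proof.
move=> /eqP hq; have qE := val_base_change f (coords_neq0 q) (esym (coordsK q)).
by rewrite (on_hesse_vline _ qE) ?map_mx_eq0 ?coords_neq0 // map_hesse hq rmorph0.
Qed.

Lemma hesse_add_base_change q q' : on_hesse q -> on_hesse q' ->
  base_change_pt f (hesse_add q q') = hesse_add (base_change_pt f q) (base_change_pt f q').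
Proof.
move=> hq hq'; have [b b0 e] := hesse_addE six hq hq'; apply/val_inj.
have qE := val_base_change f (coords_neq0 q) (esym (coordsK q)).
have qE' := val_base_change f (coords_neq0 q') (esym (coordsK q')).
have w0 : map_mx f (hesse_law b (coords q) (coords q')) != 0 by rewrite map_mx_eq0.
rewrite (val_base_change f b0 e); rewrite map_hesse_law in w0 *.
by rewrite (val_hesse_add six' _ _ qE qE' w0) // on_hesse_base_change.
Qed.
End BaseChangeHesse.

Section RootPoints.
Variables (m D : nat) (K : fieldExtType rat) (L : fieldType) (iota : {rmorphism K -> L}).
Variable r : 'I_(2 * m + 3) -> L.
Hypothesis D_odd : odd D.
Hypothesis r_inj : injective r.
Hypothesis r_roots : root_poly m D L = 4 *: \prod_i ('X - (r i)%:P).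

Local Notation E := (rational_points (hesse_variety K) iota).

Let natr0 n : n.+1%:R != 0 :> L := char0_nat iota n.

Definition root_w (x : L) := x / D%:R.
Definition root_t (x : L) := (2 * \prod_(a <- root_nodes m L) (x - a))^-1.

Let D0 : D%:R != 0 :> L.
Proof. by case: D D_odd. Qed.

Lemma root_poly_r i : root (root_poly m D L) (r i).
Proof.
rewrite r_roots rootZ ?natr0 // /root horner_prod prodf_seq_eq0.
by apply/hasP; exists i; rewrite ?mem_index_enum //= hornerXsubC subrr.
Qed.

Lemma root_t_neq0 i : root_t (r i) != 0 /\ chart_rel (root_w (r i)) (root_t (r i)).
Proof.
have := root_poly_r i; rewrite /root horner_root_poly subr_eq0 => /eqP e.
rewrite /root_t /root_w; set P := \prod_(_ <- _) _ in e *.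
have P0 : P != 0.
  apply/eqP => P0; move/eqP: e; rewrite P0 expr0n mulr0 mul0r eq_sym.
  have: (0 < 3 * D ^ 3)%N by rewrite muln_gt0 expn_gt0; case: D D_odd.
  by case: (3 * D ^ 3)%N => // n _; rewrite (negPf (natr0 n)).
split; first by rewrite invr_eq0 mulf_neq0 ?natr0.
rewrite /chart_rel chart_polyE; apply/eqP.
have D3 : 4 * P ^+ 2 * D%:R ^+ 3 != 0 by rewrite !mulf_neq0 ?expf_neq0 ?natr0.
apply: (mulIf D3); transitivity ((3 * D ^ 3)%:R : L).
  by field; rewrite P0 natr0.
by rewrite -e; field.
Qed.

Definition root_pt i : projpt L 2 :=
  proj_class (chart_neq0 (natr0 5) (root_w (r i)) (root_t (r i))).

Fact root_pt_on i : on iota (hesse_set K) (root_pt i).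
Proof.
rewrite on_hesse_set (on_hesse_vline _ (val_proj_class _)) ?chart_neq0 ?natr0 //.
by apply/eqP/chart_on; have [] := root_t_neq0 i.
Qed.

Definition root_point i : E := exist _ (root_pt i) (root_pt_on i).

Lemma root_point_inj : injective root_point.
Proof.
move=> i j /(congr1 (fun q : E => val (val q))) /= e; apply: r_inj.
have := chart_inj (natr0 1) e (chart_neq0 (natr0 5) _ _).
by move/(mulIf (invr_neq0 D0)).
Qed.

Lemma root_point_base_change (f : {rmorphism L -> L}) i j :
  f (r i) = r j -> base_change_pt f (root_pt i) = root_pt j.
Proof.
move=> fij; apply/val_inj.
rewrite (val_base_change f (chart_neq0 (natr0 5) _ _) (val_proj_class _)) /=.
congr (<[_]>%VS); rewrite map_row3.
have wE : f (root_w (r i)) = root_w (r j) by rewrite fmorph_div rmorph_nat fij.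
have tE : f (root_t (r i)) = root_t (r j).
  rewrite /root_t fmorphV rmorphM rmorph_nat rmorph_prod /root_nodes !big_map.
  by congr (_ * _)^-1; apply: eq_bigr => k _; rewrite rmorphB fij rmorph_nat.
congr row3.
- by rewrite rmorphD rmorphB /= rmorph_nat wE tE.
- by rewrite !rmorphB /= rmorph_nat wE tE.
by rewrite rmorphN rmorphD rmorphM /= !rmorph_nat wE.
Qed.

Lemma root_point_sub_torsion i j n :
  (0 < n)%N -> (root_point i - root_point j) *+ n = 0 -> i = j.
Proof.
move=> n0 tors; have [R [R_total R2]] := exists_valuation_ring natr0.
have mR2 : nonunit R 2 by rewrite /nonunit R2 orbT.
have near k : exists z, near_zero R z (root_pt k).
  have [r0 mr _] := root_poly_root_inv R_total mR2 D_odd (root_poly_r k).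
  have [t0 wt] := root_t_neq0 k.
  apply: (near_zero_chart R_total mR2 _ t0 _ wt (val_proj_class _)).
    by rewrite mulf_neq0 ?invr_eq0.
  by rewrite invfM invrK nonunitM ?rpred_nat.
have [z zi] := near i; have [z' zj] := near j.
have on_root k : on_hesse (root_pt k) by rewrite -(on_hesse_set iota) root_pt_on.
have [z'' zj'] := near_zero_opp R_total mR2 zj.
have [t zij] := near_zero_add R_total mR2 (natr0 5) (on_root i) (hesse_neg_on (on_root j)) zi zj'.
apply: root_point_inj; apply/eqP; rewrite -subr_eq0; apply/eqP.
exact: (near_zero_torsion R_total mR2 (natr0 5) (p := root_point i - root_point j) zij n0 tors).
Qed.

Lemma points_base_change (f : {rmorphism L -> L}) : exists g : {additive E -> E},
  forall q : E, val (g q) = base_change_pt f (val q).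
Proof.
have fon (q : E) : on iota (hesse_set K) (base_change_pt f (val q)).
  by rewrite on_hesse_set on_hesse_base_change // points_on_hesse.
pose g (q : E) : E := exist _ (base_change_pt f (val q)) (fon q).
have gD : {morph g : q q' / q + q'}.
  move=> q q'; apply/val_inj.
  exact: (hesse_add_base_change f (natr0 5) (natr0 5) (points_on_hesse q) (points_on_hesse q')).
have gN : nmod_morphism g.
  by split=> //; apply: (addIr (g 0)); rewrite -gD !add0r.
pose gm : {additive E -> E} := HB.pack g (GRing.isNmodMorphism.Build E E g gN).
by exists gm.
Qed.

Hypothesis r_sym : forall i j, exists f : {rmorphism L -> L},
  forall k, f (r k) = r (tperm i j k).

Lemma root_point_relation (a : 'I_(2 * m + 3) -> int) i j :
  \sum_k root_point k *~ a k = 0 -> a i = a j.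
Proof.
move=> rel; have [//|aij] := eqVneq (a i) (a j).
have ij : i != j by apply: contraNneq aij => ->.
have [f fE] := r_sym i j; have [g gE] := points_base_change f.
have gP k : g (root_point k) = root_point (tperm i j k).
  by apply/val_inj; rewrite gE; apply: root_point_base_change.
have rel' : \sum_k root_point k *~ a (tperm i j k) = 0.
  transitivity (\sum_k g (root_point k *~ a k)); last by rewrite -raddf_sum rel raddf0.
  rewrite (reindex_inj (@perm_inj _ (tperm i j))) /=.
  by apply: eq_bigr => k _; rewrite tpermK raddfMz gP.
have diff : (root_point i - root_point j) *~ (a i - a j) = 0.
  have : \sum_k root_point k *~ (a k - a (tperm i j k)) = 0.
    by under eq_bigr do rewrite mulrzBr; rewrite sumrB rel rel' subrr.
  rewrite (bigD1 i) //= (bigD1 j) ?(eq_sym j) //= big1 => [|k /andP[ki kj]]; last first.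
    by rewrite tpermD ?subrr // eq_sym.
  by rewrite addr0 tpermL tpermR -(opprB (a i)) mulrNz -mulNrz -mulrzDl.
apply/esym/eqP; rewrite eq_sym; apply/negPn/negP => _; case/eqP: ij.
apply: (@root_point_sub_torsion i j `|a i - a j|); first by rewrite absz_gt0 subr_eq0.
case: (a i - a j) diff => k //= kE; apply/eqP; rewrite -oppr_eq0; apply/eqP.
by rewrite -kE NegzE mulrNz.
Qed.

Lemma tens_sum (M : zmodType) (I : finType) (x : I -> M) r0 :
  tens (\sum_i x i) r0 = \sum_i tens (x i) r0.
Proof.
have t0 : tens (0 : M) r0 = 0 by apply: (addIr (tens 0 r0)); rewrite -tensDl !add0r.
exact: (big_morph (fun y => tens y r0) (@tensDl M r0) t0).
Qed.

Lemma tensMz (M : zmodType) (x : M) (z : int) : tens (x *~ z) 1 = tens x z%:~R.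
Proof.
by apply/eqP/tensQ_eqP; exists 1 => //=; rewrite -!mulrzA; congr (_ *~ _);
  rewrite numq_int denq_int; ring.
Qed.

Lemma root_points_independent (c : 'I_(2 * m + 3) -> rat) i j :
  \sum_k tens (root_point k) (c k) = 0 -> c i = c j.
Proof.
move=> rel; pose d := \prod_k denq (c k).
have d0 : d != 0 by apply/prodf_neq0 => k _; apply: denq_neq0.
have cE k : c k * d%:~R = (numq (c k) * \prod_(l | l != k) denq (c l))%:~R.
  rewrite /d (bigD1 k) //= !rmorphM /= mulrA; congr (_ * _).
  by rewrite numqE.
set a := fun k => numq (c k) * \prod_(l | l != k) denq (c l).
have : tens (\sum_k root_point k *~ a k) 1 = 0.
  rewrite tens_sum; under eq_bigr do rewrite tensMz -cE mulrC -tensZ.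
  by rewrite -scaler_sumr rel scaler0.
move/eqP/tens_eq0P => [t t0]; rewrite mulrz_suml.
under eq_bigr do rewrite -mulrzA.
move/(@root_point_relation (fun k => a k * t) i j)/(mulIf t0) => aij.
by apply: (@mulIf _ d%:~R); rewrite ?intr_eq0 // !cE -/(a i) aij.
Qed.
End RootPoints.
(** * The representation *)

(* In other words v |-> (g |-> (v *m rho g) 0 k) embeds V in the regular
   representation. *)
Lemma irr_coordinate (gT : finGroupType) (G : {group gT}) n
    (rho : mx_representation rat G n) : mx_irreducible rho ->
  exists k : 'I_n, forall v : 'rV_n,
    (forall g, g \in G -> (v *m rho g) 0 k = 0) -> v = 0.
Proof.
move=> /mx_irrP[n0 irr]; pose k := Ordinal n0; exists k => v v0.
pose B : 'M[rat]_(n, #|G|) := \matrix_(i, a) rho (enum_val a) i k.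
have BE (u : 'rV_n) : reflect (forall g, g \in G -> (u *m rho g) 0 k = 0) (u <= kermx B)%MS.
  apply: (iffP sub_kermxP) => [/rowP uB g Gg|uG].
    have := uB (enum_rank_in Gg g); rewrite !mxE => e; rewrite -[RHS]e.
    by apply: eq_bigr => i _; rewrite !mxE enum_rankK_in.
  apply/rowP => a; rewrite !mxE -[RHS](uG (enum_val a) (enum_valP a)) mxE.
  by apply: eq_bigr => i _; rewrite !mxE.
apply/eqP/negPn/negP => vn0.
have : row_full (kermx B).
  apply: irr.
    apply/mxmoduleP => g Gg; apply/row_subP => i; rewrite row_mul.
    have /BE ker_i : (row i (kermx B) <= kermx B)%MS by apply: row_sub.
    apply/BE => h Gh; rewrite -mulmxA -repr_mxM // ker_i ?groupM //.
  by apply: contraNneq vn0 => e; rewrite -submx0 -e; apply/BE.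
move=> /(submx_full (delta_mx 0 k : 'rV_n))/BE/(_ 1%g (group1 G)).
by rewrite repr_mx1 mulmx1 mxE !eqxx.
Qed.

Lemma cayley_embedding (gT : finGroupType) (G : {group gT}) p : (#|G| < p)%N ->
  exists (pt : gT -> 'I_p) (act : gT -> 'S_p) (out : 'I_p),
  [/\ {in G &, injective pt}, forall g, g \in G -> pt g != out,
      {in G &, forall g h, act h (pt g) = pt (g * h)%g} &
      {in G &, {morph act : g h / (g * h)%g}}].
Proof.
move=> Gp; pose pt g : 'I_p := widen_ord (ltnW Gp) (enum_rank_in (group1 G) g).
have pt_inj : {in G &, injective pt}.
  by move=> g h Gg Gh /(congr1 val) /= /val_inj; apply: enum_rank_in_inj.
pose f h (i : 'I_p) := if [pick g in G | pt g == i] is Some g then pt (g * h)%g else i.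
have f_in g h : g \in G -> h \in G -> f h (pt g) = pt (g * h)%g.
  move=> Gg Gh; rewrite /f; case: pickP => [g' /andP[Gg' /eqP /pt_inj->]//|/(_ g)].
  by rewrite Gg eqxx.
have f_out h i : i \notin pt @: G -> f h i = i.
  move=> iG; rewrite /f; case: pickP => // g /andP[Gg /eqP gi].
  by rewrite -gi imset_f in iG.
have fM g h i : g \in G -> h \in G -> f h (f g i) = f (g * h)%g i.
  move=> Gg Gh; have [/imsetP[k Gk ->]|iG] := boolP (i \in pt @: G).
    by rewrite !f_in ?groupM // mulgA.
  by rewrite !f_out.
have f1 i : f 1%g i = i.
  have [/imsetP[k Gk ->]|iG] := boolP (i \in pt @: G); last by rewrite f_out.
  by rewrite f_in // mulg1.
have f_inj h : h \in G -> injective (f h).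
  move=> Gh; apply: (can_inj (g := f h^-1%g)) => i.
  by rewrite fM ?groupV // mulgV f1.
have /choice[act actE] h : exists s : 'S_p, h \in G -> forall i, s i = f h i.
  have [Gh|_] := boolP (h \in G); last by exists 1%g.
  by exists (perm (f_inj h Gh)) => _ i; rewrite permE.
exists pt, act, (Ordinal Gp); split=> //.
- move=> g Gg; rewrite -val_eqE /= neq_ltn; apply/orP; left; exact: ltn_ord.
- by move=> g h Gg Gh; rewrite actE // f_in.
by move=> g h Gg Gh; apply/permP => i; rewrite permM !actE ?groupM // fM.
Qed.

Theorem theorem1p1 (gT : finGroupType) (G : {group gT}) (n : nat)
    (rho : mx_representation rat G n)
    (rho_faithful : mx_faithful rho) (rho_irreducible : mx_irreducible rho) :
  exists (K : fieldExtType rat) (L : splittingFieldType K) (A : abelianVariety K)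
         (f : {morphism 'Gal({:L} / 1%AS)%g >-> gT})
         (W : {pred tensQ (rational_points A (in_alg L))}),
    [/\ galois 1%AS {:L},
        isom 'Gal({:L} / 1%AS)%g G f,
        submod_closed W,
        (forall s, s \in 'Gal({:L} / 1%AS)%g ->
           {in W, forall w, tensQ_map (galois_act A s) w \in W}) &
        exists phi : {linear 'rV[rat]_n -> tensQ (rational_points A (in_alg L))},
          [/\ injective phi,
              (forall w, w \in W <-> exists v, phi v = w) &
              forall s, s \in 'Gal({:L} / 1%AS)%g ->
                forall v, phi (v *m rho (f s)) = tensQ_map (galois_act A s) (phi v)]].
Proof.
have [k rho_coord] := irr_coordinate rho_irreducible.
have [m p_prime Gp] : exists2 m, prime (2 * m + 3) & (#|G| < 2 * m + 3)%N.
  have [p pG p_prime] := prime_above (maxn #|G| 2).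
  move: pG; rewrite gtn_max => /andP[pG p2].
  have p_odd : odd p by case: (even_prime p_prime) p2 => [->|].
  exists (p - 3)./2; rewrite (_ : 2 * _ + 3 = p)%N //; lia.
have [D [L0 [r [D_odd r_inj r_roots r_gen r_sym]]]] := symmetric_number_field p_prime.
have [pt [act [out [pt_inj pt_out act_pt actM]]]] := cayley_embedding Gp.
have act_inj : {in G &, injective act}.
  move=> g h Gg Gh e; have := act_pt 1%g g (group1 G) Gg.
  by rewrite e act_pt // !mul1g => /esym; apply: pt_inj.
have act1 : act 1%g = 1%g.
  by apply: (mulgI (act 1%g)); rewrite -actM ?group1 // !mulg1.
pose H := [set s : gal_of {:L0} | `[< exists2 g, g \in G & gal_perm r s (act g) >]].
have H_group : group_set H.
  apply/group_setP; split=> [|s t].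
    rewrite inE; apply/asboolP; exists 1%g; rewrite ?group1 // act1.
    exact: gal_perm1.
  rewrite !inE => /asboolP[g Gg sg] /asboolP[h Gh th]; apply/asboolP.
  by exists (g * h)%g; rewrite ?groupM // actM //; apply: gal_permM.
pose E : {subfield L0} := [aspace of fixedField (Group H_group)].
pose K : fieldExtType rat := subvs_of E.
pose L : splittingFieldType K := fieldOver E.
have galH : 'Gal({:L0} / E)%g = H by apply: gal_fixedField.
pose x : 'I_(2 * m + 3) -> L := r.
have gal_act (s : gal_of {:L}) : exists2 g, g \in G & forall i, s (x i) = x (act g i).
  have [s0 + s0E] := gal_fieldOver_down s; rewrite galH inE => /asboolP[g Gg sg].
  by exists g => // i; rewrite -s0E sg.
have /choice[f0 f0P] (s : gal_of {:L}) : exists g, g \in G /\ forall i, s (x i) = x (act g i).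
  by have [g Gg sg] := gal_act s; exists g.
have f0_uniq (s : gal_of {:L}) g : g \in G -> (forall i, s (x i) = x (act g i)) -> f0 s = g.
  move=> Gg sg; have [Gf sf] := f0P s; apply: act_inj => //.
  by apply/permP => i; apply: r_inj; rewrite -[LHS]sf -[RHS]sg.
have f0M : {in 'Gal({:L} / 1%AS)%g &, {morph f0 : s t / (s * t)%g}}.
  move=> s t _ _; have [Gs sE] := f0P s; have [Gt tE] := f0P t.
  apply: f0_uniq; first exact: groupM.
  by move=> i; rewrite galM ?memvf // sE tE actM // permM.
have four : 4 != 0 :> L by apply: (char0_nat (in_alg L) 3).
have x_roots : root_poly m D L = 4 *: \prod_i ('X - (x i)%:P) := r_roots.
pose A := hesse_variety K.
pose P i : rational_points A (in_alg L) := root_point (in_alg L) D_odd x_roots i.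
have actP (s : gal_of {:L}) i : galois_act A s (P i) = P (act (f0 s) i).
  have [_ sx] := f0P s; apply/val_inj.
  exact: (root_point_base_change D (in_alg L) (f := (s : {rmorphism L -> L})) (sx i)).
pose phi (v : 'rV[rat]_n) : tensQ (rational_points A (in_alg L)) :=
  \sum_(g in G) tens (P (pt g)) ((v *m rho g^-1%g) 0 k).
have phi_lin : linear phi.
  move=> a u v; rewrite /phi scaler_sumr -big_split; apply: eq_bigr => g _ /=.
  by rewrite tensZ -tensDr mulmxDl -scalemxAl !mxE.
pose Phi : {linear 'rV[rat]_n -> tensQ (rational_points A (in_alg L))} :=
  HB.pack phi (GRing.isLinear.Build rat _ _ _ phi phi_lin).
have Phi_act (s : gal_of {:L}) v : Phi (v *m rho (f0 s)) = tensQ_map (galois_act A s) (Phi v).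
  have [Gs _] := f0P s; rewrite /= /phi linear_sum /=.
  rewrite (reindex_inj (mulIg (f0 s))) /=; apply: eq_big => [g|g]; first by rewrite groupMr.
  rewrite groupMr // => Gg; rewrite tensQ_map_tens actP act_pt //; congr (tens _ (_ 0 k)).
  by rewrite -mulmxA -repr_mxM ?groupV ?groupM // invMg mulKVg.
have x_sym i j : exists f : {rmorphism L -> L}, forall l, f (x l) = x (tperm i j l).
  by have [s sE] := r_sym (tperm i j); exists (s : {rmorphism L0 -> L0}).
have Phi_inj : injective Phi.
  apply: raddf_inj => v v0; apply: rho_coord => h Gh.
  pose c i := \sum_(g in G | pt g == i) (v *m rho g^-1%g) 0 k.
  have c_out : c out = 0.
    by apply: big_pred0 => g; apply/negbTE/negP => /andP[/pt_out/negP].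
  have c_pt g : g \in G -> c (pt g) = (v *m rho g^-1%g) 0 k.
    move=> Gg; rewrite /c (big_pred1 g) // => g' /=.
    by apply/andP/eqP => [[Gg' /eqP/pt_inj->]|->].
  have tens0 i : tens (P i) 0 = 0.
    by apply: (addIr (tens (P i) 0)); rewrite -tensDr !add0r.
  have rel : \sum_i tens (P i) (c i) = 0.
    rewrite -[RHS]v0 /= /phi (partition_big pt xpredT) //=; apply: eq_bigr => i _.
    rewrite /c (big_morph _ (tensDr (P i)) (tens0 i)).
    by apply: eq_bigr => g /andP[_ /eqP ->].
  rewrite -[h]invgK -c_pt ?groupV // -c_out.
  exact: (root_points_independent r_inj x_sym _ _ rel).
exists K, L, A, (Morphism f0M), (fun w => `[< exists v, Phi v = w >]); split.
- apply: pchar0_galois => q; rewrite !inE; apply/negbTE/negP => /andP[q_prime].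
  by case: q q_prime => // q _; apply/negP/(char0_nat (in_alg L)).
- apply/isomP; split; last first.
    apply/setP => g; apply/morphimP/idP => [[s _ _ ->]|Gg]; first by have [] := f0P s.
    have [s0 s0g] := r_sym (act g).
    have [|s sE] := @gal_fieldOver_up _ _ E s0.
      by rewrite galH inE; apply/asboolP; exists g.
    exists s; rewrite ?mem_gal1 //=; apply/esym/f0_uniq => // i.
    by rewrite [LHS]sE s0g.
  apply/subsetP => s /morphpreP[_]; rewrite !inE /= => /eqP fs.
  have [s0 _ s0E] := gal_fieldOver_down s.
  have s01 : s0 = 1%g.
    apply: gal_perm_id r_gen _ => i; have [_ sx] := f0P s.
    by rewrite [LHS]s0E [LHS]sx fs act1.
  apply/gal_eqP => y _; rewrite gal_id.
  by have := s0E y; rewrite s01 gal_id.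
- split=> [|a u v /asboolP[u' <-] /asboolP[v' <-]]; apply/asboolP.
    by exists 0; rewrite linear0.
  by exists (a *: u' + v'); rewrite linearP.
- move=> s _ w /asboolP[v <-]; apply/asboolP.
  by exists (v *m rho (f0 s)); rewrite Phi_act.
exists Phi; split=> // w; split=> [/asboolP//|wv]; exact/asboolP.
Qed.
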